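(* Fix $K\in\mathbb N$ and a realization of the random basis functions $\phi_1,\dots,\phi_K$. Assume that $\mathbb Q\big[\alpha(\Pi_n^KE_nP_{n+1}^K)(X_n)=g(X_n)\big]=0$ for all $0\le n\le N-1$. Then the implementable price $U_0^{K,m}$ converges almost surely (with respect to the sampling of the paths) to the idealized price $U_0^K$ as $m\to\infty$.
   Context: Let $d,N\ge 1$ and let $X=(X_0,\dots,X_N)$ be a discrete-time Markov process with values in $\mathbb{R}^d$ on a filtered probability space $(\Omega,\mathcal F,(\mathcal F_n)_{n=0}^N,\mathbb P)$, with $X_0=x_0$ deterministic; let $\mathbb Q\ll\mathbb P$ be a probability measure (the pricing measure), $\pi_n$ the law of $X_n$ under $\mathbb Q$, and $\mathbb E$ expectation under $\mathbb Q$. Let $g:\mathbb{R}^d\to[0,\infty)$ be a measurable payoff with $g(X_n)$ square integrable under $\mathbb Q$ for all $n$, and let $\alpha>0$ be the one-step discount factor. Set $\lVert f\rVert_{\pi_n}^2:=\int|f|^2d\pi_n$ and $(E_nJ)(x):=\mathbb E[J(X_{n+1})\mid X_n=x]$. Random basis functions: $\alpha_k\in\mathbb{R}^d,\beta_k\in\mathbb{R}$ with all entries i.i.d. standard Gaussian; $\phi_k(x):=\sigma(\alpha_k^\top x+\beta_k)$ with $\sigma$ a bounded activation function; $(\Phi_K\theta)(x):=\sum_{k=1}^K\theta_k\phi_k(x)$; $\Pi_n^KJ:=\arg\min_{\Phi_K\theta}\lVert J-\Phi_K\theta\rVert_{\pi_n}$ (the $L^2(\pi_n)$-projection onto $\mathrm{span}(\phi_1,\dots,\phi_K)$).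 Idealized algorithm: $P_N^K:=g$ and, for $n<N$, $P_n^K:=g\,\mathbf 1_{\{g\ge\alpha\Pi_n^KE_nP_{n+1}^K\}}+\alpha E_nP_{n+1}^K\,\mathbf 1_{\{g<\alpha\Pi_n^KE_nP_{n+1}^K\}}$; $\tilde Q_0^K:=\alpha E_0P_1^K$; idealized price $U_0^K:=\max(g(x_0),\tilde Q_0^K(x_0))$. Implementable algorithm: let $(x_1^i,\dots,x_N^i)$, $i=1,\dots,m$, be i.i.d. samples of $(X_1,\dots,X_N)$ under $\mathbb Q$. Set $p_N^i:=g(x_N^i)$ and recursively for $n=N-1,\dots,1$: let $\hat\theta_n\in\mathbb R^K$ be a minimizer of $\theta\mapsto\frac1m\sum_{i=1}^m\big(p_{n+1}^i-(\Phi_K\theta)(x_n^i)\big)^2$ (the fitted values $(\Phi_K\hat\theta_n)(x_n^i)$ do not depend on the choice of minimizer; this is the empirical projection $\hat\Pi_n^K$ of the one-sample conditional expectation), and set $p_n^i:=g(x_n^i)$ if $g(x_n^i)\ge\alpha(\Phi_K\hat\theta_n)(x_n^i)$, and $p_n^i:=\alpha p_{n+1}^i$ otherwise. The implementable price is $U_0^{K,m}:=\max\big(g(x_0),\frac1m\sum_{i=1}^m\alpha p_1^i\big)$.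
   Formalization: The Markov property of X is assumed under the pricing measure ℚ (for the natural filtration) rather than under ℙ; with X Markov only under ℙ the claim can fail for N ≥ 3. The activation function is also assumed measurable. *)

(* Defs.v *)
From HB Require Import structures.
From mathcomp Require Import all_boot all_order all_algebra.
From mathcomp Require Import all_classical all_reals all_analysis.
Set Implicit Arguments.
Unset Strict Implicit.
Unset Printing Implicit Defensive.
Import Order.TTheory GRing.Theory Num.Theory.
Local Open Scope ring_scope.
Local Open Scope classical_set_scope.

(* State space R^d is represented by d.-tuple R, which carries the product
   (= Borel) sigma-algebra generated by the coordinate maps. *)

Section Defs.
Context {R : realType} (d N K : nat).
Local Notation S := (d.-tuple R).

Definition dotp (a x : S) : R := \sum_(j < d) tnth a j * tnth x j.

Definition Phi (sig : R -> R) (alp : 'I_K -> S) (bet : 'I_K -> R)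
  (th : 'I_K -> R) (x : S) : R :=
  \sum_(k < K) th k * sig (dotp (alp k) x + bet k).

(* (E_n J)(x) = E[J(X_{n+1}) | X_n = x], computed with the transition kernel *)
Definition condE (kap : nat -> R.-pker S ~> S) (n : nat) (J : S -> R) (x : S) : R :=
  fine (\int[kap n x]_y (J y)%:E)%E.

Definition l2sq {dO} {Om : measurableType dO} (Q : probability Om R)
  (X : nat -> Om -> S) (n : nat) (f : S -> R) : \bar R :=
  (\int[Q]_w ((f (X n w)) ^+ 2)%:E)%E.

(* Idealized algorithm: P^K_{N-k} built from the coefficients theta_n of the
   projections Pi^K_n E_n P^K_{n+1} = Phi_K theta_n *)
Fixpoint Paux (kap : nat -> R.-pker S ~> S) (g : S -> R) (alpha : R)
  (sig : R -> R) (alp : 'I_K -> S) (bet : 'I_K -> R)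
  (theta : nat -> 'I_K -> R) (k : nat) : S -> R :=
  match k with
  | 0 => g
  | k'.+1 => fun x =>
      let n := (N - k'.+1)%N in
      if alpha * Phi sig alp bet (theta n) x <= g x then g x
      else alpha * condE kap n (Paux kap g alpha sig alp bet theta k') x
  end.

Definition Pideal kap g alpha sig alp bet theta (n : nat) : S -> R :=
  Paux kap g alpha sig alp bet theta (N - n).

Definition price_ideal kap g alpha sig alp bet theta (x0 : S) : R :=
  Num.max (g x0) (alpha * condE kap 0 (Pideal kap g alpha sig alp bet theta 1) x0).

(* Implementable algorithm on samples y i n (= x_n^i), with regression
   coefficients th n (= hat theta_n): p_{N-k}^i *)
Fixpoint paux (g : S -> R) (alpha : R) (sig : R -> R) (alp : 'I_K -> S)
  (bet : 'I_K -> R) (y : nat -> nat -> S) (th : nat -> 'I_K -> R)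
  (k : nat) (i : nat) : R :=
  match k with
  | 0 => g (y i N)
  | k'.+1 =>
      let n := (N - k'.+1)%N in
      if alpha * Phi sig alp bet (th n) (y i n) <= g (y i n) then g (y i n)
      else alpha * paux g alpha sig alp bet y th k' i
  end.

Definition pemp g alpha sig alp bet y th (n i : nat) : R :=
  paux g alpha sig alp bet y th (N - n) i.

(* empirical least-squares loss at time n (up to the factor 1/m) *)
Definition emp_loss g alpha sig alp bet y th (m n : nat) (th' : 'I_K -> R) : R :=
  \sum_(i < m) (pemp g alpha sig alp bet y th n.+1 i
                - Phi sig alp bet th' (y i n)) ^+ 2.

Definition price_emp g alpha sig alp bet y th (x0 : S) (m : nat) : R :=
  Num.max (g x0) (m%:R^-1 * \sum_(i < m) alpha * pemp g alpha sig alp bet y th 1 i).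

Definition samplepath {T : Type} (Z : nat -> T -> S) (w : T) : N.-tuple S :=
  [tuple Z j.+1 w | j < N].

End Defs.

(* Main.v *)
(** Let q_n be the pathwise value at date n of the stopping rule using the ideal
    coefficients theta, and p_n that of the rule using the fitted ones. By
    backward induction on n the sample mean of |p_n - q_n| tends to 0 almost
    surely.
    - Regression: in an L^2(pi_n)-orthonormal basis psi of the span of the
      features, the empirical Gram matrix tends to the identity and, because
      E[q_(n+1) | X_n] = E_n P_(n+1), the empirical means of
      (q_(n+1) - Phi theta_n) psi_j tend to 0. Hence the empirical normal
      equations force Phi hat-theta_n - Phi theta_n to 0 uniformly over the
      samples, the features being bounded.
    - Stopping: p_n and q_n can take different decisions only at samples where
      |alpha Phi theta_n - g| is below that uniform error, and by the no-tie
      assumption the contribution of these samples vanishes in the limit.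
    All averages are averages of square-integrable variables, so the elementary
    strong law along squares suffices. *)

Require Import Defs.
From HB Require Import structures.
From mathcomp Require Import all_boot all_order all_algebra.
From mathcomp Require Import all_classical all_reals all_analysis.
From mathcomp Require Import measurable_realfun ring lra.
Import Order.TTheory GRing.Theory Num.Theory.
Import numFieldNormedType.Exports.
Set Implicit Arguments.
Unset Strict Implicit.
Unset Printing Implicit Defensive.
Local Open Scope ring_scope.
Local Open Scope classical_set_scope.

(** * Monotone linear functionals *)

(** The values [p_n] depend on all m samples through [thhat], so no law of large numbers applies to
    them directly. The values [q_n] have frozen coefficients and are functions of a single path,
    hence i.i.d. across samples; this is why the comparison goes through them. The features may be
    linearly dependent in [L^2(pi_n)], so neither [theta] nor [thhat] need be unique and the
    coefficients need not converge. Only fitted values can be compared, and orthonormalising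
    discards the redundant directions. The relations expressing the features in the new basis then
    hold only up to a null set of [pi_n], which has to be carried over to the sample points. The
    induction variable is the time to maturity [k = N - n], and it stops at date 1, because date 0
    is neither sampled nor regressed. Both the sampling law and the Markov property are hypotheses
    about sets. Each is extended to functions by one principle: a monotone linear functional is
    determined by its values on indicators. *)

Section MonotoneLinearFunctionals.
Local Open Scope ereal_scope.
Context {R : realType}.

(** Expectations composed with a map, a weight or a kernel all have this form, so they can be
    compared without being exhibited as integrals against a single measure. *)
Definition mono_linear d (S : measurableType d)
    (I : (S -> \bar R) -> \bar R) : Prop :=
  [/\ forall f h : S -> \bar R, measurable_fun setT f -> measurable_fun setT h ->
        (forall x, 0 <= f x) -> (forall x, 0 <= h x) ->
        I (fun x => f x + h x) = I f + I h,
      forall (k : R) (f : S -> \bar R), (0 <= k)%R -> measurable_fun setT f ->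
        (forall x, 0 <= f x) -> I (fun x => k%:E * f x) = k%:E * I f
    & forall (f_ : nat -> S -> \bar R) (f : S -> \bar R),
        (forall n, measurable_fun setT (f_ n)) -> (forall n x, 0 <= f_ n x) ->
        (forall x, {homo f_ ^~ x : m n / (m <= n)%N >-> m <= n}) ->
        (forall x, f_ ^~ x @ \oo --> f x) ->
        I (f_ n) @[n --> \oo] --> I f].

Import HBNNSimple.

(** Additivity and scaling carry the agreement from indicators to simple functions, and the
    increasing approximations [nnsfun_approx] carry it to the limit. *)
Lemma eq_mono_linear d (S : measurableType d) (I1 I2 : (S -> \bar R) -> \bar R) :
  mono_linear I1 -> mono_linear I2 ->
  (forall A, measurable A ->
     I1 (fun x => (\1_A x)%:E) = I2 (fun x => (\1_A x)%:E)) ->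
  forall f : S -> \bar R, measurable_fun setT f -> (forall x, 0 <= f x) ->
    I1 f = I2 f.
Proof.
move=> [add1 scale1 lim1] [add2 scale2 lim2] I12 f mf f0.
have mind (A : set S) : measurable A ->
    measurable_fun setT (fun x => (\1_A x)%:E : \bar R).
  by move=> mA; exact/measurable_EFinP/measurable_indic.
have I0 (I : (S -> \bar R) -> \bar R) : mono_linear I -> I (fun=> 0) = 0.
  move=> [_ scaleI _].
  have := scaleI 0%R (fun=> 0) (lexx _) (measurable_cst _) (fun=> lexx _).
  by rewrite !mul0e.
have Isum (s : seq R) (h : {nnsfun S >-> R}) : (forall r, r \in s -> 0 <= r)%R ->
    I1 (fun x => \sum_(r <- s) (r * \1_(h @^-1` [set r]) x)%:E) =
    I2 (fun x => \sum_(r <- s) (r * \1_(h @^-1` [set r]) x)%:E).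
  elim: s => [_|r s IHs rs].
    by under eq_fun do rewrite big_nil; rewrite !I0.
  have r0 : (0 <= r)%R by apply: rs; rewrite mem_head.
  have mr : measurable (h @^-1` [set r]) by exact: measurable_sfunP.
  have m1 : measurable_fun setT
      (fun x => (r * \1_(h @^-1` [set r]) x)%:E : \bar R).
    exact/measurable_EFinP/measurable_funM.
  have s0 x q : (q \in s -> 0 <= (q * \1_(h @^-1` [set q]) x)%:E :> \bar R).
    by move=> qs; rewrite lee_fin mulr_ge0// rs// inE qs orbT.
  have ms : measurable_fun setT
      (fun x => \sum_(q <- s) (q * \1_(h @^-1` [set q]) x)%:E : \bar R).
    apply: emeasurable_sum => q; apply/measurable_EFinP/measurable_funM => //.
  under [in LHS]eq_fun do rewrite big_cons.
  under [in RHS]eq_fun do rewrite big_cons.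
  have p1 x : 0 <= (r * \1_(h @^-1` [set r]) x)%:E :> \bar R.
    by rewrite lee_fin mulr_ge0.
  have p2 x : 0 <= \sum_(q <- s) (q * \1_(h @^-1` [set q]) x)%:E :> \bar R.
    by rewrite big_seq; apply: sume_ge0 => q qs; exact: s0.
  rewrite add1// add2// IHs; last by move=> q qs; apply: rs; rewrite inE qs orbT.
  congr (_ + _); under [in LHS]eq_fun do rewrite EFinM.
  under [in RHS]eq_fun do rewrite EFinM.
  rewrite scale1//; last exact: mind.
  by rewrite scale2// ?I12//; exact: mind.
have Insf (h : {nnsfun S >-> R}) :
    I1 (EFin \o h) = I2 (EFin \o h).
  have -> : EFin \o h = (fun x => \sum_(r <- finmap.enum_fset (fset_set (range h)))
      (r * \1_(h @^-1` [set r]) x)%:E).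
    by apply/funext => x/=; rewrite [in LHS](fimfunE h) fsbig_finite//= -sumEFin.
  apply: Isum => r; rewrite in_fset_set// inE => -[x _ <-]; exact: fun_ge0.
pose f_ := nnsfun_approx measurableT mf.
have mf_ n : measurable_fun setT (EFin \o f_ n) by exact/measurable_EFinP.
have f_0 n x : 0 <= (EFin \o f_ n) x by rewrite lee_fin.
have nd x : {homo (fun n => (EFin \o f_ n) x) : m n / (m <= n)%N >-> m <= n}.
  by move=> m n mn; rewrite lee_fin; exact/lefP/nd_nnsfun_approx.
have cv x : (fun n => (EFin \o f_ n) x) @ \oo --> f x.
  exact: cvg_nnsfun_approx.
have l1 := lim1 _ f mf_ f_0 nd cv.
have l2 := lim2 _ f mf_ f_0 nd cv.
rewrite -(cvg_lim _ l1)// -(cvg_lim _ l2)//.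
suff -> : (fun n => I1 (EFin \o f_ n)) = (fun n => I2 (EFin \o f_ n)) by [].
by apply/funext => n; exact: Insf.
Qed.

(** The weight [u] lets a joint expectation be treated one argument at a time: it freezes one
    factor, such as an indicator or a function of another sample, while [psi] varies. *)
Lemma mono_linear_integral_comp d d' (T : measurableType d)
    (S : measurableType d') (mu : {measure set T -> \bar R}) (h : T -> S)
    (u : T -> R) :
  measurable_fun setT h -> measurable_fun setT u -> (forall t, 0 <= u t)%R ->
  mono_linear (fun psi : S -> \bar R => \int[mu]_t ((u t)%:E * psi (h t))).
Proof.
move=> mh mu_ u0.
have mE : measurable_fun setT (EFin \o u) by exact/measurable_EFinP.
split.
- move=> f k mf mk f0 k0; rewrite -ge0_integralD//.
  + by apply: eq_integral => t _; rewrite ge0_muleDr.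
  + by move=> t _; rewrite mule_ge0// lee_fin.
  + by apply: emeasurable_funM => //; exact: measurableT_comp.
  + by move=> t _; rewrite mule_ge0// lee_fin.
  + by apply: emeasurable_funM => //; exact: measurableT_comp.
- move=> k f k0 mf f0; rewrite -ge0_integralZl_EFin//.
  + by apply: eq_integral => t _; rewrite muleCA.
  + by move=> t _; rewrite mule_ge0// lee_fin.
  + by apply: emeasurable_funM => //; exact: measurableT_comp.
- move=> f_ f mf f0 nd cv.
  have -> : (fun t => (u t)%:E * f (h t)) =
      (fun t => lim ((u t)%:E * f_ n (h t) @[n --> \oo])).
    by apply/funext => t; apply/esym/cvg_lim => //; exact: cvgeZl.
  apply: cvg_monotone_convergence => //.
  + by move=> n; apply: emeasurable_funM => //; exact: measurableT_comp.
  + by move=> n t _; rewrite mule_ge0// lee_fin.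
  + by move=> t _ m n mn; apply: lee_wpmul2l; [rewrite lee_fin|exact: (nd (h t))].
Qed.

End MonotoneLinearFunctionals.

(** * Square-integrable functions *)

(** First-order optimality along one direction, shared by the population and the empirical least
    squares. The test value is [b / (c + 1)] rather than [b / c], since [c] may vanish. *)
Lemma quadratic_ge0_linear_eq0 (R : realFieldType) (b c : R) : 0 <= c ->
  (forall t, t *+ 2 * b <= t ^+ 2 * c) -> b = 0.
Proof.
move=> c0 key; apply/eqP; rewrite eq_le.
have c1 : 0 < c + 1 by rewrite ltr_pwDr.
have kb := key (b / (c + 1)).
have : b ^+ 2 <= 0.
  have e : (b / (c + 1)) * (c + 1) = b by rewrite divfK// gt_eqF.
  set t := b / (c + 1) in kb e.
  by rewrite -e in kb *; nra.
by move=> b2; have := sqr_ge0 b; nra.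
Qed.

Section SquareIntegrable.
Context {R : realType} {d : measure_display} {T : measurableType d}.
Variable mu : probability T R.

Definition sqint (f : T -> R) : Prop :=
  measurable_fun setT f /\
  mu.-integrable setT (EFin \o (fun x => f x ^+ 2)).

Lemma sqint_measurable f : sqint f -> measurable_fun setT f.
Proof. by case. Qed.

Lemma integrable_leR (f h : T -> R) : measurable_fun setT f ->
  (forall x, `|f x| <= h x) ->
  mu.-integrable setT (EFin \o h) -> mu.-integrable setT (EFin \o f).
Proof.
move=> mf fh; apply: le_integrable => //; first exact/measurable_EFinP.
by move=> x _ /=; rewrite lee_fin (le_trans (fh x))// ler_norm.
Qed.

Lemma sqint_le (f h : T -> R) : measurable_fun setT f ->
  (forall x, `|f x| <= `|h x|) -> sqint h -> sqint f.
Proof.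
move=> mf fh [mh ih]; split => //; apply: integrable_leR ih.
  exact: measurable_funX.
move=> x; rewrite normrX -(real_normK (num_real (h x))).
by rewrite lerXn2r// nnegrE.
Qed.

Lemma sqint_cst (c : R) : sqint (cst c).
Proof.
split; first exact: measurable_cst.
exact: (finite_measure_integrable_cst mu (c ^+ 2) measurableT).
Qed.

Lemma sqint_mul (f h : T -> R) : sqint f -> sqint h ->
  mu.-integrable setT (EFin \o (fun x => f x * h x)).
Proof.
move=> [mf if2] [mh ih2].
have ifh := integrableD measurableT if2 ih2.
apply: (@integrable_leR _ (fun x => f x ^+ 2 + h x ^+ 2)) => //.
  exact: measurable_funM.
move=> x; rewrite normrM -(real_normK (num_real (f x))) -(real_normK (num_real (h x))).
by have := normr_ge0 (f x); have := normr_ge0 (h x); nra.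
Qed.

Lemma sqint_integrable (f : T -> R) : sqint f -> mu.-integrable setT (EFin \o f).
Proof.
move=> sf; have := sqint_mul sf (sqint_cst 1); congr (mu.-integrable _ _).
by apply/funext => x /=; rewrite mulr1.
Qed.

Lemma sqintD (f h : T -> R) : sqint f -> sqint h -> sqint (fun x => f x + h x).
Proof.
move=> sf sh; split; first exact: measurable_funD sf.1 sh.1.
have i1 := integrableD measurableT sf.2 sh.2.
have i2 := integrableZl measurableT 2 i1.
apply: (@integrable_leR _ (fun x => 2 * (f x ^+ 2 + h x ^+ 2))) => //.
  exact: measurable_funX (measurable_funD sf.1 sh.1).
by move=> x; rewrite ger0_norm ?sqr_ge0//; have := sqr_ge0 (f x - h x); nra.
Qed.

Lemma sqintZ (c : R) (f : T -> R) : sqint f -> sqint (fun x => c * f x).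
Proof.
move=> sf; split; first exact: measurable_funM sf.1.
have := integrableZl measurableT (c ^+ 2) sf.2; congr (mu.-integrable _ _).
by apply/funext => x /=; rewrite exprMn.
Qed.

Lemma sqintB (f h : T -> R) : sqint f -> sqint h -> sqint (fun x => f x - h x).
Proof.
move=> sf sh; have := sqintD sf (sqintZ (-1) sh); congr sqint.
by apply/funext => x; rewrite mulN1r.
Qed.

Lemma sqint_sum (I : Type) (s : seq I) (f : I -> T -> R) :
  (forall i, sqint (f i)) -> sqint (fun x => \sum_(i <- s) f i x).
Proof.
move=> sf; elim: s => [|i s IHs].
  by under eq_fun do rewrite big_nil; exact: sqint_cst.
by under eq_fun do rewrite big_cons; exact: sqintD.
Qed.

Lemma sqint_bounded (f : T -> R) (M : R) : measurable_fun setT f ->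
  (forall x, `|f x| <= M) -> sqint f.
Proof.
move=> mf fM; apply: (@sqint_le _ (cst `|M|)) => //; last exact: sqint_cst.
by move=> x; rewrite normr_id (le_trans (fM x))// ler_norm.
Qed.

Lemma sqintM_bounded (f h : T -> R) (M : R) : sqint f ->
  measurable_fun setT h -> (forall x, `|h x| <= M) ->
  sqint (fun x => f x * h x).
Proof.
move=> sf mh hM; apply: (@sqint_le _ (fun x => M * f x)); last exact: sqintZ.
  exact: measurable_funM sf.1 mh.
by move=> x; rewrite !normrM mulrC ler_wpM2r// (le_trans (hM x))// ler_norm.
Qed.

Lemma Rintegral_sum (I : Type) (s : seq I) (f : I -> T -> R) :
  (forall i, mu.-integrable setT (EFin \o f i)) ->
  \int[mu]_x (\sum_(i <- s) f i x) = \sum_(i <- s) \int[mu]_x f i x.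
Proof.
move=> intf; elim: s => [|i s IHs].
  rewrite big_nil; under eq_Rintegral do rewrite big_nil.
  by rewrite Rintegral_cst// mul0r.
rewrite big_cons -IHs -RintegralD//; last first.
  have := integrable_sum measurableT s (P := xpredT) (fun i _ => intf i).
  congr (mu.-integrable _ _).
  by apply/funext => x /=; rewrite sumEFin.
by apply: eq_Rintegral => x _; rewrite big_cons.
Qed.

Lemma Rintegral_cst1 (c : R) : \int[mu]_x c = c.
Proof. by rewrite Rintegral_cst// [X in _ * fine X]probability_setT mulr1. Qed.

Lemma Rintegral_sqr_eq0 (f : T -> R) : sqint f ->
  \int[mu]_x (f x ^+ 2) = 0 -> {ae mu, forall x, f x = 0}.
Proof.
move=> [mf if2] f0.
have fin := integrable_fin_num measurableT if2.
have : (\int[mu]_x `|(EFin \o (fun x => (f x ^+ 2)%R)) x| = 0)%E.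
  under eq_integral do rewrite /= ger0_norm ?sqr_ge0//.
  by rewrite -(fineK fin) -[X in X%:E]/(\int[mu]_x (f x ^+ 2)) f0.
move/ae_eq_integral_abs => /(_ measurableT (measurable_int _ if2)).
apply: filterS => x /= /(_ Logic.I) [] /eqP.
by rewrite sqrf_eq0 => /eqP.
Qed.

Lemma EFin_Rintegral (f : T -> R) : mu.-integrable setT (EFin \o f) ->
  (\int[mu]_x f x)%:E = (\int[mu]_x (f x)%:E)%E.
Proof. by move=> fi; rewrite fineK//; exact: integrable_fin_num. Qed.

Lemma least_squares_orthogonal (f h : T -> R) : sqint f -> sqint h ->
  (forall t : R, \int[mu]_x (f x ^+ 2) <= \int[mu]_x ((f x - t * h x) ^+ 2)) ->
  \int[mu]_x (f x * h x) = 0.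
Proof.
move=> sf sh fmin.
have ifh := sqint_mul sf sh.
set b := \int[mu]_x (f x * h x); set c := \int[mu]_x (h x ^+ 2).
have c0 : 0 <= c by apply: Rintegral_ge0 => x _; rewrite sqr_ge0.
have expand t : \int[mu]_x ((f x - t * h x) ^+ 2) =
    \int[mu]_x (f x ^+ 2) + ((- t *+ 2) * b + t ^+ 2 * c).
  have i1 : mu.-integrable setT (EFin \o (fun x => (- t *+ 2) * (f x * h x))).
    exact: (integrableZl measurableT (- t *+ 2) ifh).
  have i2 : mu.-integrable setT (EFin \o (fun x => t ^+ 2 * h x ^+ 2)).
    exact: (integrableZl measurableT (t ^+ 2) sh.2).
  rewrite -RintegralZl// -[X in _ + (_ + X)]RintegralZl//; last exact: sh.2.
  have i3 := integrableD measurableT i1 i2.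
  rewrite -RintegralD// -RintegralD//; last exact: sf.2.
  by apply: eq_Rintegral => x _; ring.
by apply: (quadratic_ge0_linear_eq0 c0) => t; move: (fmin t); rewrite expand; nra.
Qed.

End SquareIntegrable.

(** * Orthonormalisation of possibly dependent functions *)

Section GramSchmidt.
Context {R : realType} {d : measure_display} {T : measurableType d}.
Variable mu : probability T R.

Lemma RintegralZ (c : R) (f : T -> R) : mu.-integrable setT (EFin \o f) ->
  \int[mu]_x (c * f x) = c * \int[mu]_x f x.
Proof. by move=> fi; rewrite RintegralZl. Qed.

(* The normalisation fails when a function is a.e. in the span of the previous
   ones, so the family is only recovered almost everywhere. *)
Lemma gram_schmidt (I : finType) (phi : I -> T -> R) :
  (forall k, sqint mu (phi k)) ->
  exists (r : nat) (psi : nat -> T -> R) (a : nat -> I -> R) (c : I -> nat -> R),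
  [/\ forall j x, psi j x = \sum_k a j k * phi k x,
      forall i j, (i < r)%N -> (j < r)%N ->
        \int[mu]_x (psi i x * psi j x) = (i == j)%:R
    & forall k, {ae mu, forall x, phi k x = \sum_(j < r) c k j * psi j x}].
Proof.
move=> sphi.
(* Induction over the functions already processed. The coefficients [a] range over all of [I], so
   that each [psi j] is a combination of the [phi] at every point, not merely almost everywhere. *)
suff: forall s : seq I,
  exists (r : nat) (psi : nat -> T -> R) (a : nat -> I -> R) (c : I -> nat -> R),
  [/\ forall j x, psi j x = \sum_k a j k * phi k x,
      forall i j, (i < r)%N -> (j < r)%N ->
        \int[mu]_x (psi i x * psi j x) = (i == j)%:R
    & forall k, k \in s ->
        {ae mu, forall x, phi k x = \sum_(j < r) c k j * psi j x}].
  move=> /(_ (enum I)) [r [psi [a [c [h1 h2 h3]]]]].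
  by exists r, psi, a, c; split => // k; apply: h3; rewrite mem_enum.
elim=> [|k0 s [r [psi [a [c [psiE orth phiE]]]]]].
  exists 0%N, (fun _ _ => 0), (fun _ _ => 0), (fun _ _ => 0); split => // j x.
  by rewrite big1// => k _; rewrite mul0r.
have spsi j : sqint mu (psi j).
  rewrite (_ : psi j = (fun x => \sum_k a j k * phi k x)).
    by apply: sqint_sum => k; exact: sqintZ.
  by apply/funext => x; exact: psiE.
pose b j := \int[mu]_x (phi k0 x * psi j x).
pose rho x := phi k0 x - \sum_(j < r) b j * psi j x.
have srho : sqint mu rho.
  by apply: sqintB => //; apply: sqint_sum => j; exact: sqintZ.
have rho_orth i : (i < r)%N -> \int[mu]_x (rho x * psi i x) = 0.
  move=> ir; transitivity (\int[mu]_x (phi k0 x * psi i x -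
      \sum_(j < r) b j * (psi j x * psi i x))).
    apply: eq_Rintegral => x _; rewrite mulrBl mulr_suml; congr (_ - _).
    by apply: eq_bigr => j _; rewrite mulrA.
  have ipsi j : mu.-integrable setT (EFin \o (fun x => psi j x * psi i x)).
    exact: sqint_mul.
  have iZ j : mu.-integrable setT (EFin \o (fun x => b j * (psi j x * psi i x))).
    exact: (integrableZl measurableT (b j) (ipsi j)).
  rewrite RintegralB//; last 2 first.
  - exact: sqint_mul.
  - have := integrable_sum measurableT (index_enum 'I_r) (P := xpredT)
      (fun j _ => iZ j).
    by congr (mu.-integrable _ _); apply/funext => x /=; rewrite sumEFin.
  rewrite (Rintegral_sum (mu := mu) (index_enum 'I_r)
    (f := fun j x => b j * (psi j x * psi i x)))//.
  rewrite (eq_bigr (fun j : 'I_r => b j * (j == Ordinal ir)%:R)); last first.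
    by move=> j _; rewrite RintegralZ// orth.
  rewrite (bigD1 (Ordinal ir))//= eqxx mulr1 big1 ?addr0 ?subrr//.
  by move=> j /negbTE ->; rewrite mulr0.
(* If the residual has norm zero, [phi k0] already lies in the span almost everywhere: the family is
   kept and [b] gives the coordinates. *)
have [rho0|rho_neq0] := eqVneq (\int[mu]_x (rho x ^+ 2)) 0.
  exists r, psi, a, (fun k => if k == k0 then b else c k); split => // k.
  have [-> _|kk0] := eqVneq k k0; last by rewrite inE (negbTE kk0); exact: phiE.
  apply: filterS (Rintegral_sqr_eq0 srho rho0) => x /eqP.
  by rewrite subr_eq0 => /eqP.
pose q := Num.sqrt (\int[mu]_x (rho x ^+ 2)).
have q_gt0 : 0 < q.
  rewrite sqrtr_gt0 lt_def rho_neq0/=; apply: Rintegral_ge0 => x _.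
  exact: sqr_ge0.
have q2 : q ^+ 2 = \int[mu]_x (rho x ^+ 2).
  by rewrite sqr_sqrtr//; apply: Rintegral_ge0 => x _; exact: sqr_ge0.
have q_neq0 : q != 0 by rewrite gt_eqF.
(* The new vector is [rho / q]. Substituting [psiE] in [rho] gives its coefficients on the [phi],
   and [phi k0 = q psi_r + sum_j b_j psi_j] gives the new row of [c]. *)
exists r.+1, (fun j => if j == r then fun x => q^-1 * rho x else psi j),
  (fun j k => if j == r then q^-1 * ((k == k0)%:R - \sum_(i < r) b i * a i k)
              else a j k),
  (fun k j => if k == k0 then if j == r then q else b j
              else if j == r then 0 else c k j); split.
- move=> j x; have [_|_] := eqVneq j r; last exact: psiE.
  rewrite /rho; under [X in _ - X]eq_bigr do rewrite psiE.
  transitivity (q^-1 * (\sum_k (k == k0)%:R * phi k x -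
      \sum_k (\sum_(i < r) b i * a i k) * phi k x)).
    congr (_ * (_ - _)).
      rewrite (bigD1 k0)//= eqxx mul1r big1 ?addr0// => k /negbTE ->.
      by rewrite mul0r.
    under eq_bigr do rewrite mulr_sumr.
    rewrite exchange_big; apply: eq_bigr => k _; rewrite mulr_suml.
    by apply: eq_bigr => i _; rewrite mulrA.
  rewrite -sumrB mulr_sumr; apply: eq_bigr => k _.
  by rewrite -mulrBl mulrA.
- have irp i : (i < r)%N -> \int[mu]_x (q^-1 * (rho x * psi i x)) = 0.
    by move=> ir; rewrite RintegralZ ?rho_orth ?mulr0//; exact: sqint_mul.
  move=> i j; rewrite !ltnS.
  have [->{i} _|ir irr] := eqVneq i r; have [->{j} _|jr jrr] := eqVneq j r.
  + transitivity (\int[mu]_x (q ^- 2 * rho x ^+ 2)).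
      by apply: eq_Rintegral => x _; rewrite -exprVn; ring.
    by rewrite RintegralZ ?srho.2// -q2 mulVf// expf_neq0.
  + rewrite -[RHS](irp j); last by rewrite ltn_neqAle jr.
    by apply: eq_Rintegral => x _; rewrite mulrA.
  + rewrite (negbTE ir) -[RHS](irp i); last by rewrite ltn_neqAle ir.
    by apply: eq_Rintegral => x _; ring.
  + by apply: orth; rewrite ltn_neqAle ?ir ?jr.
- move=> k; have [->{k} _|kk0] := eqVneq k k0.
    apply: aeW => x; rewrite big_ord_recr /= eqxx mulVKf//.
    rewrite (eq_bigr (fun j : 'I_r => b j * psi j x)) ?/rho ?(addrC _ (_ - _)) ?subrK//.
    by move=> j _; rewrite ltn_eqF.
  rewrite inE (negbTE kk0) => /phiE; apply: filterS => x ->.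
  rewrite big_ord_recr /= eqxx mul0r addr0; apply: eq_bigr => j _.
  by rewrite ltn_eqF.
Qed.

End GramSchmidt.

(** * Strong law of large numbers *)

Section StrongLaw.
Context {R : realType}.

(** Monotonicity fills the gaps between squares: at an index between two consecutive squares the
    average is squeezed between the values at these squares, up to a ratio that tends to 1. *)
Lemma cvg_average_squares (A : nat -> R) (m : R) :
  (forall n, 0 <= A n) -> {homo A : i j / (i <= j)%N >-> i <= j} ->
  (fun k => (k.+1%:R ^+ 2)^-1 * A (k.+1 ^ 2)%N) @ \oo --> m ->
  (fun n => n%:R^-1 * A n) @ \oo --> m.
Proof.
move=> A0 ndA Am; rewrite -cvg_shiftS.
have root n : exists j, (j.+1 ^ 2 <= n.+1 < j.+2 ^ 2)%N.
  elim: n => [|n [j /andP[jn nj]]]; first by exists 0%N.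
  have [|nj'] := leqP (j.+2 ^ 2) n.+2; last first.
    by exists j; rewrite nj' (leq_trans jn).
  move=> h; exists j.+1; rewrite h (leq_ltn_trans nj)// ltn_exp2r//.
have [j jP] := choice root.
have joo : j n @[n --> \oo] --> \oo.
  apply/cvgnyPge => B; near=> n.
  have /andP[_ h] := jP n; rewrite -ltnS -ltnS -(@ltn_exp2r _ _ 2)//.
  apply: leq_ltn_trans h; near: n; exact: nbhs_infty_ge.
have hoo : harmonic (j n) @[n --> \oo] --> (0 : R).
  exact: cvg_comp joo cvg_harmonic.
have j1oo : (j n).+1 @[n --> \oo] --> \oo.
  apply/cvgnyPge => B; move/cvgnyPge : joo => /(_ B); apply: filterS => n.
  exact: leqW.
have h1oo : harmonic (j n).+1 @[n --> \oo] --> (0 : R).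
  exact: cvg_comp j1oo cvg_harmonic.
have bj := cvg_comp _ _ joo Am.
have bj1 := cvg_comp _ _ j1oo Am.
(* The correcting factors exchange the normalisations at the two squares:
   [1 - 1/(j+2) = (j+1)/(j+2)] and [1 + 1/(j+1) = (j+2)/(j+1)]. *)
apply: (@squeeze_cvgr _ _ _ _
  (fun n => ((j n).+1%:R ^+ 2)^-1 * A ((j n).+1 ^ 2)%N * (1 - harmonic (j n).+1) ^+ 2)
  (fun n => ((j n).+2%:R ^+ 2)^-1 * A ((j n).+2 ^ 2)%N * (1 + harmonic (j n)) ^+ 2)).
- near=> n; have /andP[jn nj] := jP n.
  have jn' : ((j n).+1%:R : R) ^+ 2 <= n.+1%:R by rewrite -natrX ler_nat.
  have nj' : n.+1%:R <= ((j n).+2%:R : R) ^+ 2 by rewrite -natrX ler_nat ltnW.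
  have e1 : ((j n).+1%:R ^+ 2)^-1 * (1 - harmonic (j n).+1) ^+ 2 =
      ((j n).+2%:R ^+ 2)^-1 :> R.
    rewrite /harmonic /= -(natr1 (j n).+1); field.
    by have := ler0n R (j n) => j0; rewrite ?andbT; do ?[apply/andP; split]; apply: lt0r_neq0; lra.
  have e2 : ((j n).+2%:R ^+ 2)^-1 * (1 + harmonic (j n)) ^+ 2 =
      ((j n).+1%:R ^+ 2)^-1 :> R.
    rewrite /harmonic /= -(natr1 (j n).+1); field.
    by have := ler0n R (j n) => j0; rewrite ?andbT; do ?[apply/andP; split]; apply: lt0r_neq0; lra.
  rewrite /= !(mulrAC _ (A _)) e1 e2; apply/andP; split.
    apply: ler_pM; [by rewrite invr_ge0 sqr_ge0|exact: A0| |exact: ndA].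
    by rewrite lef_pV2 ?posrE ?exprn_gt0//.
  apply: ler_pM; [by rewrite invr_ge0|exact: A0| |exact/ndA/ltnW].
  by rewrite lef_pV2 ?posrE ?exprn_gt0//.
- have h : (fun n => 1 - harmonic (j n).+1) @ \oo --> (1 - 0 : R).
    by apply: cvgB => //; exact: cvg_cst.
  have := cvgM bj (cvgM h h); rewrite subr0 !mulr1; exact.
- have h : (fun n => 1 + harmonic (j n)) @ \oo --> (1 + 0 : R).
    by apply: cvgD => //; exact: cvg_cst.
  have := cvgM bj1 (cvgM h h); rewrite addr0 !mulr1; exact.
Unshelve. all: by end_near. Qed.

Lemma harmonic2_partial_sum (n : nat) :
  \sum_(k < n) (k.+1%:R ^+ 2)^-1 <= 2 :> R.
Proof.
(* The sharper bound makes the induction close by telescoping: [1/t^2 <= 2/t - 2/(t+1)] for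
   [t >= 1]. *)
suff : \sum_(k < n) (k.+1%:R ^+ 2)^-1 <= 2 - 2 / n.+1%:R :> R.
  by move=> h; apply: (le_trans h); rewrite gerBl divr_ge0.
elim: n => [|n IHn]; first by rewrite big_ord0 divr1 subrr.
rewrite big_ord_recr/=; apply: le_trans (lerD IHn (lexx _)) _.
have n1 : 1 <= n.+1%:R :> R by rewrite ler1n.
have -> : n.+2%:R = n.+1%:R + 1 :> R by rewrite natr1.
move: (n.+1%:R : R) n1 => t t1; rewrite -subr_ge0.
have -> : 2 - 2 / (t + 1) - (2 - 2 / t + (t ^+ 2)^-1) =
    (t - 1) / (t ^+ 2 * (t + 1)) by field; lra.
by rewrite divr_ge0 ?mulr_ge0 ?sqr_ge0//; lra.
Qed.

Context {d : measure_display} {T : measurableType d}.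
Variable mu : probability T R.

(** Plays the part of Borel-Cantelli: by monotone convergence the series of the [u k] has a finite
    integral, so it is finite almost everywhere and its terms tend to 0. *)
Lemma ae_cvg0_summable (u : nat -> T -> R) (C : R) :
  (forall k, mu.-integrable setT (EFin \o u k)) -> (forall k x, 0 <= u k x) ->
  (forall n, \sum_(k < n) \int[mu]_x u k x <= C) ->
  {ae mu, forall x, u ^~ x @ \oo --> (0 : R)}.
Proof.
move=> iu u0 uC.
pose W x : \bar R := (\sum_(k <oo) (u k x)%:E)%E.
have mu_ k : measurable_fun setT (EFin \o u k) := measurable_int _ (iu k).
have W0 x : (0 <= W x)%E by apply: nneseries_ge0 => k _ _; rewrite lee_fin.
have mW : measurable_fun setT W.
  apply: ge0_emeasurable_sum => [k x _ _|k _].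
    by rewrite lee_fin.
  exact: mu_.
have iW : mu.-integrable setT W.
  apply/integrableP; split => //; apply: (@le_lt_trans _ _ C%:E); last exact: ltry.
  under eq_integral do rewrite gee0_abs//.
  rewrite integral_nneseries//; last by move=> k x _; rewrite lee_fin.
  apply: lime_le.
    by apply: is_cvg_nneseries => k _ _; apply: integral_ge0 => x _; rewrite lee_fin.
  apply: nearW => n; rewrite big_mkord.
  under eq_bigr do rewrite -EFin_Rintegral//.
  by rewrite sumEFin lee_fin.
apply: filterS (integrable_ae measurableT iW) => x /(_ Logic.I) Wfin.
apply: cvg_series_cvg_0; apply: nondecreasing_is_cvgn.
  by apply/nondecreasing_seqP => n; rewrite /series/= big_nat_recr//= lerDl.
exists (fine (W x)) => _ [n _ <-].
rewrite -lee_fin fineK// /series/= -sumEFin.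
by apply: nneseries_lim_ge => k _ _; rewrite lee_fin.
Qed.

Lemma uncorrelated_sum_sqr (eta : nat -> T -> R) (V : R) :
  (forall i, sqint mu (eta i)) ->
  (forall i, \int[mu]_x (eta i x ^+ 2) <= V) ->
  (forall i j, i != j -> \int[mu]_x (eta i x * eta j x) = 0) ->
  forall n, \int[mu]_x ((\sum_(i < n) eta i x) ^+ 2) <= n%:R * V.
Proof.
move=> seta etaV orth; elim=> [|n IHn].
  under eq_Rintegral do rewrite big_ord0 expr0n.
  by rewrite Rintegral_cst// !mul0r.
have sS : sqint mu (fun x => \sum_(i < n) eta i x).
  by apply: sqint_sum => i.
have iSe := sqint_mul sS (seta n).
have cross : \int[mu]_x ((\sum_(i < n) eta i x) * eta n x) = 0.
  under eq_Rintegral do rewrite mulr_suml.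
  rewrite (Rintegral_sum (mu := mu) (index_enum 'I_n)
    (f := fun i x => eta i x * eta n x)); last by move=> i; exact: sqint_mul.
  by rewrite big1// => i _; rewrite orth// ltn_eqF.
have i2 : mu.-integrable setT
    (EFin \o (fun x => 2 * ((\sum_(i < n) eta i x) * eta n x))).
  exact: (integrableZl measurableT 2 iSe).
have i3 := integrableD measurableT i2 (seta n).2.
rewrite (_ : \int[mu]_x _ = \int[mu]_x ((\sum_(i < n) eta i x) ^+ 2 +
   (2 * ((\sum_(i < n) eta i x) * eta n x) + eta n x ^+ 2))); last first.
  by apply: eq_Rintegral => x _; rewrite big_ord_recr/=; ring.
rewrite RintegralD//; last exact: sS.2.
rewrite RintegralD//; last exact: (seta n).2.
rewrite RintegralZ// cross mulr0 add0r -natr1 mulrDl mul1r.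
exact: lerD.
Qed.

(** Along the squares the centred average has second moment at most [V / (k+1)^2], which is
    summable. Nonnegativity makes the partial sums monotone, as needed between squares. [V] is the
    raw second moment, an upper bound for the variance. *)
Lemma slln_nonneg (xi : nat -> T -> R) (m V : R) :
  (forall i, sqint mu (xi i)) -> (forall i x, 0 <= xi i x) ->
  (forall i, \int[mu]_x xi i x = m) ->
  (forall i, \int[mu]_x (xi i x ^+ 2) = V) ->
  (forall i j, i != j -> \int[mu]_x (xi i x * xi j x) = m ^+ 2) ->
  {ae mu, forall x, (fun n => n%:R^-1 * \sum_(i < n) xi i x) @ \oo --> m}.
Proof.
move=> sxi xi0 Exi Exi2 Exixj.
pose eta i x := xi i x - m.
have ixi i := sqint_integrable (sxi i).
have seta i : sqint mu (eta i).
  exact: (sqintB (sxi i) (sqint_cst mu m)).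
have etaM i j : \int[mu]_x (eta i x * eta j x) =
    \int[mu]_x (xi i x * xi j x) - m ^+ 2.
  have iZ k : mu.-integrable setT (EFin \o (fun x => m * xi k x)).
    exact: (integrableZl measurableT m (ixi k)).
  have ic : mu.-integrable setT (EFin \o (fun=> m ^+ 2)).
    exact: (finite_measure_integrable_cst mu (m ^+ 2) measurableT).
  have i1 := integrableB measurableT (sqint_mul (sxi i) (sxi j)) (iZ i).
  have i2 := integrableB measurableT i1 (iZ j).
  transitivity (\int[mu]_x (xi i x * xi j x - m * xi i x - m * xi j x + m ^+ 2)).
    by apply: eq_Rintegral => x _; rewrite /eta; ring.
  rewrite RintegralD// RintegralB// RintegralB//; last exact: sqint_mul.
  rewrite (RintegralZ m (ixi i)) (RintegralZ m (ixi j)) !Exi Rintegral_cst1.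
  by ring.
have eta2 i : \int[mu]_x (eta i x ^+ 2) <= V.
  rewrite -(Exi2 i); under eq_Rintegral do rewrite expr2.
  by rewrite etaM; under [leRHS]eq_Rintegral do rewrite expr2; rewrite gerBl sqr_ge0.
have orth i j : i != j -> \int[mu]_x (eta i x * eta j x) = 0.
  by move=> ij; rewrite etaM Exixj// subrr.
have Sle := uncorrelated_sum_sqr seta eta2 orth.
have V0 : 0 <= V by rewrite -(Exi2 0%N); apply: Rintegral_ge0 => x _; exact: sqr_ge0.
pose avg k x := (k.+1%:R ^+ 2)^-1 * \sum_(i < k.+1 ^ 2) eta i x.
have savg k : sqint mu (avg k) by apply: sqintZ; exact: sqint_sum.
have := @ae_cvg0_summable (fun k x => avg k x ^+ 2) (V * 2)
  (fun k => (savg k).2) (fun k x => sqr_ge0 _).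
have avgV n : \sum_(k < n) \int[mu]_x (avg k x ^+ 2) <= V * 2.
  apply: le_trans (ler_wpM2l V0 (harmonic2_partial_sum n)).
  rewrite mulr_sumr; apply: ler_sum => k _; rewrite /avg.
  have sS : sqint mu (fun x => \sum_(i < k.+1 ^ 2) eta i x) by exact: sqint_sum.
  under eq_Rintegral do rewrite exprMn.
  rewrite RintegralZ; last exact: sS.2.
  apply: (le_trans (ler_wpM2l _ (Sle _))); first by rewrite sqr_ge0.
  rewrite natrX expr2 -mulrA (mulrA _ _ V) mulVf ?mul1r; last by rewrite expf_neq0.
  by rewrite mulrC.
move=> /(_ avgV); apply: filterS => x /= avg0.
have {}avg0 : avg ^~ x @ \oo --> (0 : R).
  apply/cvgr0Pnorm_lt => e e0; have e20 : 0 < e ^+ 2 by rewrite exprn_gt0.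
  move/cvgr0Pnorm_lt : avg0 => /(_ _ e20); apply: filterS => k.
  by rewrite normrX ltr_pXn2r// nnegrE// ltW.
apply: (@cvg_average_squares (fun n => \sum_(i < n) xi i x)).
- by move=> n; apply: sumr_ge0.
- apply/nondecreasing_seqP => n; rewrite big_ord_recr/= lerDl//.
- have : (fun k => avg k x + m) @ \oo --> 0 + m.
    by apply: cvgD => //; exact: cvg_cst.
  rewrite add0r; apply: cvg_trans; apply: near_eq_cvg; apply: nearW => k.
  rewrite /avg /eta sumrB sumr_const card_ord mulrBr -[m *+ _]mulr_natr natrX.
  by rewrite mulrCA mulVf ?expf_neq0// mulr1 subrK.
Qed.

End StrongLaw.

(** * Moments and averages of independent copies *)

Section IndependentSamples.
Context {R : realType} {dO dS dU : measure_display}.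
Context {Om : measurableType dO} {Sm : measurableType dS} {U : measurableType dU}.
Variables (Q : probability Om R) (P : probability Sm R).
Variables (Z : Om -> U) (W : nat -> Sm -> U).
Hypothesis mZ : measurable_fun setT Z.
Hypothesis mW : forall i, measurable_fun setT (W i).
Hypothesis W_law : forall i A, measurable A -> P (W i @^-1` A) = Q (Z @^-1` A).
Hypothesis W_pair : forall i j A B, i != j -> measurable A -> measurable B ->
  P (W i @^-1` A `&` W j @^-1` B) = (Q (Z @^-1` A) * Q (Z @^-1` B))%E.

Let mpre (d1 d2 : measure_display) (T1 : measurableType d1)
  (T2 : measurableType d2) (f : T1 -> T2) A :
  measurable_fun setT f -> measurable A -> measurable (f @^-1` A).
Proof. by move=> mf mA; rewrite -[_ @^-1` _]setTI; exact: mf. Qed.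

Let indE (d1 d2 : measure_display) (T1 : measurableType d1)
    (T2 : measurableType d2) (mu : {measure set T1 -> \bar R}) (f : T1 -> T2)
    (c : R) (A : set T2) :
  measurable_fun setT f -> measurable A -> 0 <= c ->
  (\int[mu]_t (c%:E * (\1_A (f t))%:E) = c%:E * mu (f @^-1` A))%E.
Proof.
move=> mf mA c0; rewrite ge0_integralZl_EFin//.
- by congr (_ * _)%E; rewrite -(setIT (f @^-1` A)) -integral_indic//; exact: mpre.
- by apply/measurable_EFinP; exact: measurableT_comp (measurable_indic mA) mf.
Qed.

Lemma sample_integral i (F : U -> \bar R) : measurable_fun setT F ->
  (forall u, 0 <= F u)%E -> (\int[P]_s F (W i s) = \int[Q]_w F (Z w))%E.
Proof.
move=> mF F0.
have := @eq_mono_linear R _ U _ _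
  (@mono_linear_integral_comp R _ _ _ _ P _ (cst 1) (mW i) (measurable_cst _) _)
  (@mono_linear_integral_comp R _ _ _ _ Q _ (cst 1) mZ (measurable_cst _) _).
move=> /(_ (fun=> ler01) (fun=> ler01)) /(_ _ F mF F0) h.
transitivity (\int[P]_s ((cst (1:R) s)%:E * F (W i s)))%E.
  by apply: eq_integral => s _; rewrite mul1e.
rewrite h; last first.
  by move=> A mA; rewrite /cst !indE//; congr (_ * _)%E; exact: W_law.
by apply: eq_integral => s _; rewrite mul1e.
Qed.

(** Two passes: first [F] varies with [\1_B (W j)] as weight, where agreement on indicators is
    [W_pair]; then [G] varies with [F (W i)] as weight. Finiteness of the mean of [F] lets it serve
    as the real weight [m] in the second pass. *)
Lemma sample_integralM i j (F G : U -> R) : i != j ->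
  measurable_fun setT F -> (forall u, 0 <= F u) ->
  measurable_fun setT G -> (forall u, 0 <= G u) ->
  (\int[Q]_w (F (Z w))%:E < +oo)%E ->
  (\int[P]_s ((F (W i s))%:E * (G (W j s))%:E) =
   \int[Q]_w (F (Z w))%:E * \int[Q]_w (G (Z w))%:E)%E.
Proof.
move=> ij mF F0 mG G0 Foo.
have mFW : measurable_fun setT (F \o W i) by exact: measurableT_comp.
have mFZ : measurable_fun setT (F \o Z) by exact: measurableT_comp.
pose m := fine (\int[Q]_w (F (Z w))%:E)%E.
have mE : (m%:E = \int[Q]_w (F (Z w))%:E)%E.
  rewrite fineK// ge0_fin_numE//.
  by apply: integral_ge0 => w _; rewrite lee_fin.
have m0 : 0 <= m by apply: fine_ge0; apply: integral_ge0 => w _; rewrite lee_fin.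
have EG : measurable_fun setT (EFin \o G) by exact/measurable_EFinP.
have EG0 u : (0 <= (EFin \o G) u)%E by rewrite lee_fin.
have EF : measurable_fun setT (EFin \o F) by exact/measurable_EFinP.
have EF0 u : (0 <= (EFin \o F) u)%E by rewrite lee_fin.
have step (B : set U) : measurable B ->
    (\int[P]_s ((F (W i s))%:E * (\1_B (W j s))%:E) = m%:E * Q (Z @^-1` B))%E.
  move=> mB.
  have mI : measurable_fun setT (\1_B \o W j : Sm -> R).
    exact: measurableT_comp (measurable_indic mB) (mW j).
  have qfin : Q (Z @^-1` B) \is a fin_num by exact: fin_num_measure (mpre _ _).
  have q0 : 0 <= fine (Q (Z @^-1` B)) by exact: fine_ge0.
  have := @eq_mono_linear R _ U _ _
    (@mono_linear_integral_comp R _ _ _ _ P _ _ (mW i) mI (fun=> ler0n _ _))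
    (@mono_linear_integral_comp R _ _ _ _ Q _ (cst (fine (Q (Z @^-1` B))))
       mZ (measurable_cst _) (fun=> q0)).
  move=> /(_ _ (EFin \o F) EF EF0) h.
  under eq_integral do rewrite muleC.
  rewrite h.
    rewrite /cst ge0_integralZl_EFin//.
    - by rewrite fineK// muleC mE.
    - exact: measurableT_comp EF mZ.
  move=> A mA; rewrite /cst indE// fineK//.
  rewrite (eq_integral (fun s => (\1_(W i @^-1` A `&` W j @^-1` B) s)%:E)).
    rewrite integral_indic// ?setIT; last by apply: measurableI; exact: mpre.
    by rewrite muleC; exact: W_pair.
  by move=> s _ /=; rewrite indicI /= -EFinM mulrC.
have := @eq_mono_linear R _ U _ _
  (@mono_linear_integral_comp R _ _ _ _ P _ _ (mW j) mFW (fun s => F0 _))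
  (@mono_linear_integral_comp R _ _ _ _ Q _ (cst m) mZ (measurable_cst _)
     (fun=> m0)).
move=> /(_ _ (EFin \o G) EG EG0) ->; last first.
  by move=> B mB; rewrite /cst indE// -step.
rewrite /cst ge0_integralZl_EFin ?mE//.
exact: measurableT_comp EG mZ.
Qed.

Let slln_samples_nonneg (F : U -> R) : (forall u, 0 <= F u) ->
  measurable_fun setT F -> sqint Q (F \o Z) ->
  {ae P, forall s, (fun n => n%:R^-1 * \sum_(i < n) F (W i s)) @ \oo -->
     (\int[Q]_w F (Z w) : R)}.
Proof.
move=> F0 mF sF.
have mF2 : measurable_fun setT (fun u => (F u ^+ 2)%:E : \bar R).
  exact/measurable_EFinP/measurable_funX.
have mF1 : measurable_fun setT (fun u => (F u)%:E : \bar R).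
  exact/measurable_EFinP.
have sFW i : sqint P (F \o W i).
  split; first exact: measurableT_comp.
  apply/integrableP; split.
    by apply/measurable_EFinP/measurable_funX; exact: measurableT_comp.
  rewrite (eq_integral (fun s => (F (W i s) ^+ 2)%:E)); last first.
    by move=> s _; rewrite /= ger0_norm ?sqr_ge0.
  rewrite (sample_integral i (F := fun u => (F u ^+ 2)%:E))//.
    by have := integrable_lty measurableT sF.2.
  by move=> u; rewrite lee_fin sqr_ge0.
apply: (@slln_nonneg _ _ _ P (fun i => F \o W i) _
  (\int[Q]_w (F (Z w) ^+ 2))) => //.
- move=> i s; exact: F0.
- move=> i; rewrite /Rintegral.
  by rewrite (sample_integral i (F := fun u => (F u)%:E)).
- move=> i; rewrite /Rintegral.
  rewrite (sample_integral i (F := fun u => (F u ^+ 2)%:E))// => u.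
  by rewrite lee_fin sqr_ge0.
- move=> i j ij; rewrite /Rintegral /=.
  under eq_integral do rewrite EFinM.
  have iF := sqint_integrable sF.
  rewrite sample_integralM//; last by have := integrable_lty measurableT iF.
  by rewrite -EFin_Rintegral// -EFinM expr2.
Qed.

(** Positive and negative parts are treated separately, because the law along squares needs monotone
    partial sums. *)
Lemma slln_samples (F : U -> R) : measurable_fun setT F -> sqint Q (F \o Z) ->
  {ae P, forall s, (fun n => n%:R^-1 * \sum_(i < n) F (W i s)) @ \oo -->
     (\int[Q]_w F (Z w) : R)}.
Proof.
move=> mF sF.
pose Fp u := Num.max (F u) 0; pose Fn u := Num.max (- F u) 0.
have mFp : measurable_fun setT Fp by exact: measurable_maxr.
have mFn : measurable_fun setT Fn.
  by apply: measurable_maxr => //; exact: measurableT_comp.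
have sFp : sqint Q (Fp \o Z).
  apply: sqint_le sF; first exact: measurableT_comp.
  by move=> w /=; rewrite /Fp; case: (leP (F (Z w)) 0) => // _; rewrite normr0.
have sFn : sqint Q (Fn \o Z).
  apply: sqint_le sF; first exact: measurableT_comp.
  move=> w /=; rewrite /Fn; case: (leP (- F (Z w)) 0) => // _; rewrite ?normr0//.
  by rewrite normrN.
have Fpn u : F u = Fp u - Fn u.
  by rewrite /Fp /Fn; case: (leP (F u) 0); case: (leP (- F u) 0) => *; lra.
have Fp0 u : 0 <= Fp u by rewrite le_max lexx orbT.
have Fn0 u : 0 <= Fn u by rewrite le_max lexx orbT.
apply: filterS2 (slln_samples_nonneg Fp0 mFp sFp)
  (slln_samples_nonneg Fn0 mFn sFn) => s cp cn.
have -> : \int[Q]_w F (Z w) = \int[Q]_w Fp (Z w) - \int[Q]_w Fn (Z w).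
  rewrite -RintegralB//; [|exact: sqint_integrable sFp|exact: sqint_integrable sFn].
  by apply: eq_Rintegral => w _; rewrite Fpn.
apply: cvg_trans; last exact: (cvgB cp cn).
apply: near_eq_cvg; apply: nearW => n.
transitivity (n%:R^-1 * \sum_(i < n) Fp (W i s) -
  n%:R^-1 * \sum_(i < n) Fn (W i s)) => //.
rewrite -mulrBr -sumrB; congr (_ * _).
by apply: eq_bigr => i _; rewrite -Fpn.
Qed.

Lemma sample_ae (C : set U) : measurable C -> Q (Z @^-1` C) = 0%E ->
  {ae P, forall s, forall i, ~ C (W i s)}.
Proof.
move=> mC C0; apply: (ae_foralln (P := fun i s => ~ C (W i s))) => i.
exists (W i @^-1` C); split; first exact: mpre.
  by rewrite -C0; exact: W_law.
by move=> s /= /contrapT.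
Qed.

End IndependentSamples.

(** * Empirical least squares *)

Section EmpiricalRegression.
Context {R : realType}.
Implicit Types u v : nat -> R.

Definition mean (n : nat) u : R := n%:R^-1 * \sum_(i < n) u i.

Lemma eq_mean n u v : u =1 v -> mean n u = mean n v.
Proof. by move=> uv; congr (_ * _); apply: eq_bigr. Qed.

Lemma mean_ge0 n u : (forall i, 0 <= u i) -> 0 <= mean n u.
Proof. by move=> u0; rewrite mulr_ge0// sumr_ge0. Qed.

Lemma le_mean n u v : (forall i, u i <= v i) -> mean n u <= mean n v.
Proof. by move=> uv; rewrite ler_wpM2l//; apply: ler_sum. Qed.

Lemma meanD n u v : mean n (fun i => u i + v i) = mean n u + mean n v.
Proof. by rewrite /mean big_split mulrDr. Qed.

Lemma meanZ n c u : mean n (fun i => c * u i) = c * mean n u.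
Proof. by rewrite /mean -mulr_sumr mulrCA. Qed.

Lemma mean_sum n (I : Type) (s : seq I) (h : I -> nat -> R) :
  mean n (fun i => \sum_(j <- s) h j i) = \sum_(j <- s) mean n (h j).
Proof. by rewrite /mean exchange_big -mulr_sumr. Qed.

Lemma ler_norm_mean n u : `|mean n u| <= mean n (fun i => `|u i|).
Proof.
by rewrite normrM ger0_norm// ler_wpM2l// ler_norm_sum.
Qed.

Lemma cvg_sum0 (J : Type) (s : seq J) (f : J -> nat -> R) :
  (forall j, f j n @[n --> \oo] --> (0 : R)) ->
  \sum_(j <- s) f j n @[n --> \oo] --> (0 : R).
Proof.
move=> f0; elim: s => [|j s IHs].
  by under eq_fun do rewrite big_nil; exact: cvg_cst.
under eq_fun do rewrite big_cons.
by have := cvgD (f0 j) IHs; rewrite addr0; apply.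
Qed.

(** Cauchy-Schwarz, read off from the squares of [|v j| - t] with [t = V / r.+1]. Dividing by [r.+1]
    instead of [r] covers the empty family at no real cost. *)
Lemma sum_sqr_ge (r : nat) (v : nat -> R) :
  (\sum_(j < r) `|v j|) ^+ 2 / r.+1%:R <= \sum_(j < r) v j ^+ 2.
Proof.
set V := \sum_(j < r) `|v j|; have r0 : 0 < r.+1%:R :> R by [].
pose t := V / r.+1%:R; have tV : V = t * r.+1%:R by rewrite divfK// gt_eqF.
have : 0 <= \sum_(j < r) (`|v j| - t) ^+ 2 by apply: sumr_ge0 => j _; exact: sqr_ge0.
rewrite (eq_bigr (fun j : 'I_r => v j ^+ 2 + (- (t *+ 2) * `|v j| + t ^+ 2))); last first.
  by move=> j _; rewrite -(real_normK (num_real (v j))); ring.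
rewrite !big_split/= -mulr_sumr -/V sumr_const card_ord.
have -> : V ^+ 2 / r.+1%:R = t ^+ 2 * r.+1%:R.
  by rewrite {1}tV; field; rewrite gt_eqF.
have t20 : 0 <= t ^+ 2 := sqr_ge0 t.
by rewrite {1}tV -mulr_natr -natr1; nra.
Qed.

Context {S : Type} {I : finType}.
Variables (phi : I -> S -> R) (x : nat -> S).
Variables (r : nat) (psi : nat -> S -> R) (a : nat -> I -> R) (c : I -> nat -> R).
Variable B : R.
Hypothesis psiB : forall j y, (j < r)%N -> `|psi j y| <= B.
Hypothesis phiE : forall i k, phi k (x i) = \sum_(j < r) c k j * psi j (x i).
Hypothesis gram_cvg : forall i j, (i < r)%N -> (j < r)%N ->
  mean n (fun l => psi i (x l) * psi j (x l)) @[n --> \oo] --> ((i == j)%:R : R).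

Definition feature_comb (th : I -> R) (y : S) : R := \sum_k th k * phi k y.

Lemma empirical_orthogonal (p : nat -> R) (n : nat) (th th' : I -> R) :
  (forall th2, \sum_(l < n) (p l - feature_comb th (x l)) ^+ 2 <=
     \sum_(l < n) (p l - feature_comb th2 (x l)) ^+ 2) ->
  \sum_(l < n) (p l - feature_comb th (x l)) * feature_comb th' (x l) = 0.
Proof.
move=> thmin.
have c0 : 0 <= \sum_(l < n) feature_comb th' (x l) ^+ 2.
  by apply: sumr_ge0 => l _; exact: sqr_ge0.
apply: (quadratic_ge0_linear_eq0 c0) => t.
have := thmin (fun k => th k + t * th' k).
have combE l : feature_comb (fun k => th k + t * th' k) (x l) =
    feature_comb th (x l) + t * feature_comb th' (x l).
  rewrite /feature_comb mulr_sumr -big_split/=; apply: eq_bigr => k _; ring.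
under [leRHS]eq_bigr => l _.
  rewrite combE.
  rewrite (_ : _ ^+ 2 = (p l - feature_comb th (x l)) ^+ 2 +
    (- (t *+ 2) * ((p l - feature_comb th (x l)) * feature_comb th' (x l)) +
     t ^+ 2 * feature_comb th' (x l) ^+ 2)); last by ring.
  over.
by rewrite !big_split/= -!mulr_sumr; nra.
Qed.

Variables (theta : I -> R) (thhat : nat -> I -> R).
Variables (q : nat -> R) (p : nat -> nat -> R).
Hypothesis residual_cvg : forall j, (j < r)%N ->
  mean n (fun l => (q l - feature_comb theta (x l)) * psi j (x l)) @[n --> \oo]
    --> (0 : R).
Hypothesis thhat_min : forall n th,
  \sum_(l < n) (p n l - feature_comb (thhat n) (x l)) ^+ 2 <=
  \sum_(l < n) (p n l - feature_comb th (x l)) ^+ 2.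
Hypothesis p_cvg : mean n (fun l => `|p n l - q l|) @[n --> \oo] --> (0 : R).

(** The empirical energy of the error [d] is bounded above by [V * eta] and below by a multiple of
    [V ^ 2], where [v] lists the coordinates of the error in the [psi]. Hence [V] is of the order of
    [eta], and boundedness of the [psi] turns this into a bound uniform in [l]. *)
Lemma fitted_values_cvg (e : R) : 0 < e ->
  \forall n \near \oo, forall l,
    `|feature_comb (thhat n) (x l) - feature_comb theta (x l)| <= e.
Proof.
move=> e0.
pose v n j := \sum_k (thhat n k - theta k) * c k j.
pose V n := \sum_(j < r) `|v n j|.
pose d n k := thhat n k - theta k.
pose G n (i j : nat) := mean n (fun l => psi i (x l) * psi j (x l)).
pose rho n j := mean n (fun l => (q l - feature_comb theta (x l)) * psi j (x l)).
pose eps n := \sum_(i < r) \sum_(j < r) `|G n i j - (i == j)%:R|.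
pose eta n := `|B| * mean n (fun l => `|p n l - q l|) + \sum_(j < r) `|rho n j|.
have V0 n : 0 <= V n by apply: sumr_ge0.
have dE n l : feature_comb (d n) (x l) = \sum_(j < r) v n j * psi j (x l).
  rewrite /feature_comb /v; under eq_bigr do rewrite phiE mulr_sumr.
  rewrite exchange_big/=; apply: eq_bigr => j _; rewrite mulr_suml.
  by apply: eq_bigr => k _; rewrite mulrA.
have dB n l : feature_comb (thhat n) (x l) - feature_comb theta (x l) =
    feature_comb (d n) (x l).
  by rewrite /feature_comb -sumrB; apply: eq_bigr => k _; rewrite mulrBl.
have d_le n l : `|feature_comb (d n) (x l)| <= `|B| * V n.
  rewrite dE (le_trans (ler_norm_sum _ _ _))// mulr_sumr; apply: ler_sum => j _.
  by rewrite normrM mulrC ler_wpM2r// (le_trans (psiB _ _))// ler_norm.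
(* Write [d^2 = (p - Phi theta) d - (p - Phi thhat) d]. The second product sums to zero by
   [empirical_orthogonal]; the first is split at [q] into the inherited error and the ideal
   residual. *)
have energy_le n : mean n (fun l => feature_comb (d n) (x l) ^+ 2) <= V n * eta n.
  have -> : mean n (fun l => feature_comb (d n) (x l) ^+ 2) =
      mean n (fun l => (p n l - q l) * feature_comb (d n) (x l)) +
      mean n (fun l => (q l - feature_comb theta (x l)) * feature_comb (d n) (x l)).
    rewrite -meanD /mean; congr (_ * _).
    apply/eqP; rewrite -subr_eq0 -sumrB -oppr_eq0 -sumrN.
    rewrite -[X in _ == X](empirical_orthogonal (d n) (thhat_min n)).
    apply/eqP; apply: eq_bigr => l _; rewrite -dB; ring.
  rewrite mulrDr; apply: lerD.
    apply: (le_trans (ler_norm _)); apply: (le_trans (ler_norm_mean _ _)).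
    rewrite mulrA -meanZ; apply: le_mean => l.
    rewrite normrM mulrC ler_wpM2r//; apply: (le_trans (d_le n l)).
    by rewrite mulrC.
  under eq_mean do rewrite dE mulr_sumr.
  rewrite mean_sum.
  rewrite (eq_bigr (fun j : 'I_r => v n j * rho n j)); last first.
    by move=> j _; rewrite -meanZ; apply: eq_mean => l; ring.
  apply: (le_trans (ler_norm _)); apply: (le_trans (ler_norm_sum _ _ _)).
  rewrite mulr_suml; apply: ler_sum => j _; rewrite normrM ler_wpM2l//.
  by rewrite (bigD1 j)//= lerDl sumr_ge0.
(* Replacing the Gram matrix by the identity costs at most [V^2 * eps]; [sum_sqr_ge] bounds the
   remaining sum of squares from below. *)
have energy_ge n : V n ^+ 2 / r.+1%:R - V n ^+ 2 * eps n <=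
    mean n (fun l => feature_comb (d n) (x l) ^+ 2).
  have -> : mean n (fun l => feature_comb (d n) (x l) ^+ 2) =
      \sum_(i < r) \sum_(j < r) v n i * v n j * G n i j.
    under eq_mean do rewrite dE expr2 big_distrlr/=.
    rewrite mean_sum; apply: eq_bigr => i _; rewrite mean_sum.
    by apply: eq_bigr => j _; rewrite -meanZ; apply: eq_mean => l; ring.
  have -> : \sum_(i < r) \sum_(j < r) v n i * v n j * G n i j =
      \sum_(i < r) v n i ^+ 2 +
      \sum_(i < r) \sum_(j < r) v n i * v n j * (G n i j - (i == j)%:R).
    rewrite -big_split/=; apply: eq_bigr => i _.
    rewrite (_ : v n i ^+ 2 = \sum_(j < r) v n i * v n j * (i == j)%:R).
      by rewrite -big_split/=; apply: eq_bigr => j _; ring.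
    rewrite (bigD1 i)//= eqxx mulr1 big1 ?addr0 ?expr2// => j.
    by rewrite eq_sym => /negbTE ->; rewrite mulr0.
  apply: lerD; first exact: sum_sqr_ge.
  apply: lerNnormlW.
  apply: (le_trans (ler_norm_sum _ _ _)); rewrite mulr_sumr.
  apply: ler_sum => i _; apply: (le_trans (ler_norm_sum _ _ _)).
  rewrite mulr_sumr; apply: ler_sum => j _.
  have vV k : (k < r)%N -> `|v n k| <= V n.
    move=> kr; rewrite /V (bigD1 (Ordinal kr))//= lerDl sumr_ge0//.
  by rewrite !normrM ler_wpM2r// expr2 ler_pM// vV.
have eps0 : eps n @[n --> \oo] --> (0 : R).
  apply: cvg_sum0 => i.
  apply: cvg_sum0 => j; rewrite -(normr0 R); apply: cvg_norm.
  rewrite -(subrr ((i == j)%:R : R)); apply: cvgB; last exact: cvg_cst.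
  exact: gram_cvg.
have eta0 : eta n @[n --> \oo] --> (0 : R).
  rewrite -(addr0 (0 : R)) -{1}(mulr0 `|B|); apply: cvgD.
    by apply: cvgM p_cvg; exact: cvg_cst.
  apply: cvg_sum0 => j; rewrite -(normr0 R); apply: cvg_norm.
  exact: residual_cvg.
have r0 : 0 < r.+1%:R :> R by [].
(* With [eps < 1/(2(r+1))] half of the lower bound [V^2/(r+1)] survives, so [V <= 2(r+1) eta]. The
   threshold for [eta] then gives the error [e]; [|B| + 1] replaces [|B|], which may be 0. *)
have er0 : 0 < (2 * r.+1%:R)^-1 :> R by rewrite invr_gt0 mulr_gt0.
have et0 : 0 < e / ((`|B| + 1) * (2 * r.+1%:R)).
  by rewrite divr_gt0// !mulr_gt0// ltr_pwDr.
move/cvgr0Pnorm_lt : eps0 => /(_ _ er0) near_eps.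
move/cvgr0Pnorm_lt : eta0 => /(_ _ et0) near_eta.
near=> n => l; rewrite dB (le_trans (d_le n l))//.
have en : `|eps n| < (2 * r.+1%:R)^-1 by near: n.
have hn : `|eta n| < e / ((`|B| + 1) * (2 * r.+1%:R)) by near: n.
have Vn : V n <= (2 * r.+1%:R) * eta n.
  have := le_trans (energy_ge n) (energy_le n).
  have [->|Vn0 h] := eqVneq (V n) 0.
    move=> _; rewrite mulr_ge0// addr_ge0 ?sumr_ge0// mulr_ge0// mean_ge0//.
  have Vp : 0 < V n by rewrite lt_def Vn0 V0.
  have en' := le_lt_trans (ler_norm _) en.
  have : V n * (2 * r.+1%:R)^-1 <= eta n.
    rewrite -(ler_pM2l Vp); apply: le_trans h.
    have -> : V n ^+ 2 / r.+1%:R = V n ^+ 2 * ((2 * r.+1%:R)^-1 *+ 2).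
      by field; rewrite gt_eqF.
    rewrite mulrA -expr2 -mulrBr ler_wpM2l ?sqr_ge0//.
    by move: en'; rewrite mulr2n; move: ((2 * r.+1%:R)^-1) (eps n) => t u; lra.
  by rewrite ler_pdivrMr ?mulr_gt0// mulrC.
have hn' := ltW (le_lt_trans (ler_norm _) hn).
apply: (@le_trans _ _ ((`|B| + 1) * (2 * r.+1%:R * eta n))).
  by apply: ler_pM => //; rewrite lerDl.
by rewrite mulrA -ler_pdivlMl ?mulr_gt0 ?ltr_pwDr// mulrC.
Unshelve. all: by end_near. Qed.

(* A wrong stopping decision at a sample forces the ideal margin there to be
   smaller than the regression error. *)
Lemma stopped_values_cvg (g : S -> R) (alpha : R) (p' : nat -> nat -> R)
    (q' h : nat -> R) (hb : nat -> R) : 0 < alpha ->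
  (forall n l, p' n l = if alpha * feature_comb (thhat n) (x l) <= g (x l)
                        then g (x l) else alpha * p n l) ->
  (forall l, q' l = if alpha * feature_comb theta (x l) <= g (x l)
                    then g (x l) else alpha * q l) ->
  (forall n l, 0 <= p' n l <= h l) -> (forall l, 0 <= q' l <= h l) ->
  (forall N, mean n (fun l => h l *
       (`|alpha * feature_comb theta (x l) - g (x l)| <= N.+1%:R^-1)%R%:R)
     @[n --> \oo] --> hb N) ->
  hb @ \oo --> (0 : R) ->
  mean n (fun l => `|p' n l - q' l|) @[n --> \oo] --> (0 : R).
Proof.
move=> alpha0 p'E q'E p'h q'h hbP hb0.
apply/cvgr0Pnorm_lt => e e0.
(* The margin width [1/(N+1)] is fixed before the sample size, so that the limiting contribution of
   narrow margins is below [e / 4]. The fit tolerance [1/(alpha (N+1))] matches this width, and the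
   three errors of [e / 4] stay below [e]. *)
have [N hN] : exists N, `|hb N| < e / 4.
  have e4 : 0 < e / 4 by rewrite divr_gt0.
  by move/cvgr0Pnorm_lt : hb0 => /(_ _ e4) [N _ /(_ N (leqnn N))]; exists N.
have hbN := hbP N; set u := (fun l => h l * _) in hbN.
have ea : 0 < (alpha * N.+1%:R)^-1 by rewrite invr_gt0 mulr_gt0.
have ep : 0 < e / (4 * alpha) by rewrite divr_gt0// mulr_gt0.
have e4 : 0 < e / 4 by rewrite divr_gt0.
move/cvgr0Pnorm_lt : p_cvg => /(_ _ ep) near_p.
move/cvgrPdist_lt : hbN => /(_ _ e4) near_h.
have near_fit := fitted_values_cvg ea.
near=> n.
have np : `|mean n (fun l => `|p n l - q l|)| < e / (4 * alpha) by near: n.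
have nh : `|hb N - mean n u| < e / 4 by near: n.
have nf : forall l, `|feature_comb (thhat n) (x l) - feature_comb theta (x l)| <=
   (alpha * N.+1%:R)^-1 by near: n.
have ptw l : `|p' n l - q' l| <= alpha * `|p n l - q l| + u l.
  have /andP[p0 ph] := p'h n l; have /andP[q0 qh] := q'h l.
  have h0 := le_trans p0 ph.
  have u0 : 0 <= u l by rewrite mulr_ge0.
  have a0 : 0 <= alpha * `|p n l - q l| by rewrite mulr_ge0// ltW.
  have differ : (alpha * feature_comb (thhat n) (x l) <= g (x l)) !=
      (alpha * feature_comb theta (x l) <= g (x l)) ->
      `|p' n l - q' l| <= u l.
    move=> neq; have -> : u l = h l.
      rewrite /u (_ : _ <= _) ?mulr1//.
      have := ler_wpM2l (ltW alpha0) (nf l).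
      rewrite invfM mulrA divff ?gt_eqF// mul1r -[X in X * `|_|](gtr0_norm alpha0).
      rewrite -normrM mulrBr => ab; apply: le_trans ab.
      move: neq; case: leP => h1; case: leP => h2 // _.
        have -> : `|alpha * feature_comb theta (x l) - g (x l)| =
            alpha * feature_comb theta (x l) - g (x l) by rewrite gtr0_norm ?subr_gt0.
        by rewrite distrC; apply: le_trans (ler_norm _); lra.
      have -> : `|alpha * feature_comb theta (x l) - g (x l)| =
          g (x l) - alpha * feature_comb theta (x l) by rewrite distrC ger0_norm ?subr_ge0.
      by apply: le_trans (ler_norm _); lra.
    by rewrite ler_norml; apply/andP; split; lra.
  move: differ; rewrite p'E q'E; case: ifP => _; case: ifP => _ /=.
  - by rewrite subrr normr0 addr_ge0.
  - by move=> /(_ isT) h1; apply: (le_trans h1); rewrite lerDr.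
  - by move=> /(_ isT) h1; apply: (le_trans h1); rewrite lerDr.
  - by rewrite -mulrBr normrM (gtr0_norm alpha0) lerDl.
rewrite ger0_norm ?mean_ge0//; apply: (le_lt_trans (le_mean n ptw)).
rewrite meanD meanZ.
have np' : alpha * mean n (fun l => `|p n l - q l|) < e / 4.
  have := le_lt_trans (ler_norm _) np.
  rewrite -(ltr_pM2l alpha0) => /lt_le_trans; apply.
  by rewrite le_eqVlt; apply/orP; left; apply/eqP; field; rewrite gt_eqF.
by move: nh hN; rewrite !ltr_norml => /andP[? ?] /andP[? ?]; lra.
Unshelve. all: by end_near. Qed.

End EmpiricalRegression.

(** * Markov kernels and processes *)

Section MarkovKernel.
Context {R : realType} {dO dT dT' : measure_display}.
Context {Om : measurableType dO} {S : measurableType dT} {S' : measurableType dT'}.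
Variable kap : R.-pker S ~> S'.

Lemma measurable_kernel_integral (J : S' -> \bar R) :
  measurable_fun setT J -> (forall y, 0 <= J y)%E ->
  measurable_fun setT (fun x => \int[kap x]_y J y)%E.
Proof.
move=> mJ J0; apply: measurable_fun_integral_kernel => // U mU.
exact: measurable_kernel.
Qed.

(** With [u] the indicator of a past event, this is the right-hand side of the Markov property seen
    as a functional of the test function. *)
Lemma mono_linear_kernel (mu : {measure set Om -> \bar R}) (h : Om -> S)
    (u : Om -> R) :
  measurable_fun setT h -> measurable_fun setT u -> (forall w, 0 <= u w) ->
  mono_linear (fun J : S' -> \bar R =>
    \int[mu]_w ((u w)%:E * \int[kap (h w)]_y J y))%E.
Proof.
move=> mh mu_ u0.
have [add scale lim] := @mono_linear_integral_comp R _ _ _ _ mu h u mh mu_ u0.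
split.
- move=> f k mf mk f0 k0.
  rewrite -(add (fun x => \int[kap x]_y f y)%E (fun x => \int[kap x]_y k y)%E).
  + by apply: eq_integral => w _; rewrite ge0_integralD.
  + exact: measurable_kernel_integral.
  + exact: measurable_kernel_integral.
  + by move=> x; exact: integral_ge0.
  + by move=> x; exact: integral_ge0.
- move=> k f k0 mf f0.
  rewrite -(scale k (fun x => \int[kap x]_y f y)%E)//.
  + by apply: eq_integral => w _; rewrite ge0_integralZl_EFin.
  + exact: measurable_kernel_integral.
  + by move=> x; exact: integral_ge0.
- move=> f_ f mf f0 nd cv.
  apply: (lim (fun n x => \int[kap x]_y f_ n y)%E
    (fun x => \int[kap x]_y f y)%E).
  + by move=> n; exact: measurable_kernel_integral.
  + by move=> n x; exact: integral_ge0.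
  + by move=> x m n mn; apply: ge0_le_integral => // y _; exact: (nd y).
  + move=> x; have -> : f = fun y => limn (f_ ^~ y).
      by apply/funext => y; apply/esym/cvg_lim.
    by apply: cvg_monotone_convergence => // y _; exact: (nd y).
Qed.

(* When [J] has infinite mean, [fine] makes the left-hand side [0]. *)
Lemma kernel_jensen_sqr (x : S) (J : S' -> R) : measurable_fun setT J ->
  (forall y, 0 <= J y) ->
  (((fine (\int[kap x]_y (J y)%:E)) ^+ 2)%:E <= \int[kap x]_y ((J y) ^+ 2)%:E)%E.
Proof.
move=> mJ J0; set I := (\int[kap x]_y (J y)%:E)%E; set c := fine I.
have I0 : (0 <= I)%E by apply: integral_ge0 => y _; rewrite lee_fin.
have c0 : 0 <= c by exact: fine_ge0.
have mJ2 : measurable_fun setT (fun y => ((J y) ^+ 2)%:E : \bar R).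
  exact/measurable_EFinP/measurable_funX.
have mJE : measurable_fun setT (fun y => (J y)%:E : \bar R).
  exact/measurable_EFinP.
have [Ifin|] := boolP (I \is a fin_num); last first.
  move=> nfin; rewrite /c (_ : fine I = 0); last by move: nfin; case: I {I0 c c0}.
  by rewrite expr0n/=; apply: integral_ge0 => y _; rewrite lee_fin sqr_ge0.
(* Integrates [2 c J <= J^2 + c^2], with [c] the mean of [J]; the kernel has mass one, so the left
   side becomes [2 c^2] and one [c^2] cancels. *)
have : (\int[kap x]_y ((2 * c)%:E * (J y)%:E) <=
    \int[kap x]_y (((J y) ^+ 2)%:E + (c ^+ 2)%:E))%E.
  apply: ge0_le_integral => //.
  - by move=> y _; rewrite -EFinM lee_fin !mulr_ge0.
  - exact: measurable_funeM.
  - by apply: emeasurable_funD => //; exact: measurable_cst.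
  - move=> y _; rewrite -EFinM -EFinD lee_fin.
    by have := sqr_ge0 (J y - c); nra.
rewrite ge0_integralZl_EFin//; last 2 first.
- by move=> y _; rewrite lee_fin.
- by rewrite mulr_ge0.
rewrite ge0_integralD//; last 2 first.
- by move=> y _; rewrite lee_fin sqr_ge0.
- by move=> y _; rewrite lee_fin sqr_ge0.
rewrite (@integral_cst _ _ _ (kap x) setT measurableT (c ^+ 2)%:E).
have -> : kap x setT = 1%E by exact: prob_kernel.
rewrite mule1 -/I -(fineK Ifin) -/c -EFinM => h.
rewrite -(leeD2rE (x := (c ^+ 2)%:E))//.
apply: le_trans h; rewrite -EFinD lee_fin; nra.
Qed.

End MarkovKernel.

(** * The Markov property on cylinder events *)

Section MarkovProcess.
Context {R : realType} {dO dT : measure_display}.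
Context {Om : measurableType dO} {S : measurableType dT}.
Variables (Q : probability Om R) (X : nat -> Om -> S).
Variables (kap : nat -> R.-pker S ~> S) (N : nat).
Hypothesis mX : forall n, measurable_fun setT (X n).
Hypothesis markov : forall n (B : nat -> set S) (A : set S),
  (n < N)%N -> (forall j, measurable (B j)) -> measurable A ->
  Q ((\bigcap_(j in [set j | (j <= n)%N]) (X j @^-1` B j)) `&` (X n.+1 @^-1` A))
  = (\int[Q]_(w in \bigcap_(j in [set j | (j <= n)%N]) (X j @^-1` B j))
       kap n (X n w) A)%E.

(** Cylinder events, the form in which the Markov property is given. They are stable under adding a
    decision taken from [X n] ([pastI]) and under passing to the next date ([pastS]), which is all
    that a stopping rule requires. *)
Definition past (n : nat) (C : set Om) : Prop :=
  exists2 B : nat -> set S, (forall j, measurable (B j)) &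
    C = \bigcap_(j in [set j | (j <= n)%N]) (X j @^-1` B j).

Lemma pastT n : past n setT.
Proof.
exists (fun=> setT) => //; apply/seteqP; split => // w _ j _.
Qed.

Lemma past_measurable n C : past n C -> measurable C.
Proof.
move=> [B mB ->]; apply: bigcap_measurable; first by exists 0%N.
by move=> j _; rewrite -[_ @^-1` _]setTI; exact: mX.
Qed.

Lemma pastI n C D : past n C -> measurable D -> past n (C `&` X n @^-1` D).
Proof.
move=> [B mB ->] mD.
exists (fun j => if j == n then B j `&` D else B j).
  by move=> j; case: ifP => _ //; exact: measurableI.
apply/seteqP; split => [w [wB wD] j jn|w wB]; rewrite /preimage/=.
  have Bj := wB j jn; case: eqP => [e|_] //.
  by split => //; rewrite e; exact: wD.
split=> [j jn|]; first by have := wB j jn; rewrite /preimage/=; case: ifP => // _ [].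
by have := wB n (leqnn n); rewrite /preimage/= eqxx => -[].
Qed.

Lemma pastS n C : past n C -> past n.+1 C.
Proof.
move=> [B mB ->]; exists (fun j => if (j <= n)%N then B j else setT).
  by move=> j; case: ifP.
apply/seteqP; split => [w wB j jn|w wB j jn]; rewrite /preimage/=.
  by case: ifP => // h; exact: wB.
by have := wB j (leqW jn); rewrite /preimage/= jn.
Qed.

Lemma markov_integral n C (J : S -> \bar R) : (n < N)%N -> past n C ->
  measurable_fun setT J -> (forall y, 0 <= J y)%E ->
  (\int[Q]_w ((\1_C w)%:E * J (X n.+1 w)) =
   \int[Q]_w ((\1_C w)%:E * \int[kap n (X n w)]_y J y))%E.
Proof.
move=> nN pC mJ J0; have mC := past_measurable pC.
have m1 : measurable_fun setT (\1_C : Om -> R) by exact: measurable_indic.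
have := @eq_mono_linear R _ S _ _
  (@mono_linear_integral_comp R _ _ _ _ Q _ _ (mX n.+1) m1 (fun=> ler0n _ _))
  (@mono_linear_kernel R _ _ _ _ _ _ (kap n) Q _ _ (mX n) m1 (fun=> ler0n _ _)).
apply => // A mA; case: pC mC => B mB CE mC.
have mXA : measurable (X n.+1 @^-1` A).
  by rewrite -[_ @^-1` _]setTI; exact: mX.
transitivity (Q (C `&` X n.+1 @^-1` A)).
  rewrite -[in RHS](setIT (C `&` _)) -integral_indic//; last exact: measurableI.
  by apply: eq_integral => w _; rewrite -EFinM indicI.
rewrite CE markov// -CE [LHS]integral_mkcond.
apply: eq_integral => w _.
rewrite integral_indic// setIT /patch indicE; case: ifPn => wC.
  by rewrite mul1e.
by rewrite mul0e.
Qed.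

(* For [S := d.-tuple R] this is convertible to [condE]. *)
Definition cexp (n : nat) (J : S -> R) (x : S) : R :=
  fine (\int[kap n x]_y (J y)%:E)%E.

Lemma cexp_ge0 n (J : S -> R) x : (forall y, 0 <= J y) -> 0 <= cexp n J x.
Proof. by move=> J0; apply: fine_ge0; apply: integral_ge0 => y _; rewrite lee_fin. Qed.

Lemma measurable_cexp n (J : S -> R) : measurable_fun setT J ->
  (forall y, 0 <= J y) -> measurable_fun setT (cexp n J).
Proof.
move=> mJ J0; apply: measurableT_comp; first exact: fine_measurable.
by apply: measurable_kernel_integral => [|y]; [exact/measurable_EFinP|rewrite lee_fin].
Qed.

(** Jensen under the kernel bounds the square by the kernel integral of [J^2], whose expectation is
    that of [J^2] at the next date by the Markov identity on the sure event. *)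
Lemma sqint_cexp n (J : S -> R) : (n < N)%N -> measurable_fun setT J ->
  (forall y, 0 <= J y) -> sqint Q (J \o X n.+1) -> sqint Q (cexp n J \o X n).
Proof.
move=> nN mJ J0 sJ.
have mcJ : measurable_fun setT (cexp n J \o X n).
  by apply: measurableT_comp => //; exact: measurable_cexp.
split => //; apply/integrableP; split; first exact/measurable_EFinP/measurable_funX.
have mJ2 : measurable_fun setT (fun y => ((J y) ^+ 2)%:E : \bar R).
  exact/measurable_EFinP/measurable_funX.
have J20 y : (0 <= ((J y) ^+ 2)%:E)%E by rewrite lee_fin sqr_ge0.
have /integrableP[_] := sJ.2; apply: le_lt_trans.
apply: (@le_trans _ _ (\int[Q]_w ((\1_setT w)%:E *
    \int[kap n (X n w)]_y ((J y) ^+ 2)%:E))%E).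
  apply: ge0_le_integral => //.
  - by apply/measurableT_comp => //; exact/measurable_EFinP/measurable_funX.
  - apply: emeasurable_funM; first exact/measurable_EFinP.
    exact: measurableT_comp (measurable_kernel_integral _ mJ2 J20) (mX n).
  - move=> w _; rewrite /= ger0_norm ?sqr_ge0// indicT mul1e.
    exact: kernel_jensen_sqr.
rewrite -(markov_integral nN (pastT n) mJ2 J20).
apply: ge0_le_integral => //.
- by move=> w _; rewrite indicT mul1e.
- apply: emeasurable_funM; first exact/measurable_EFinP.
  exact: measurableT_comp mJ2 (mX n.+1).
- by apply/measurableT_comp => //; exact/measurable_EFinP/measurable_funX/measurableT_comp.
- by move=> w _; rewrite indicT mul1e /= ger0_norm ?sqr_ge0.
Qed.

(** After [markov_integral] it remains to insert [fine]. This changes nothing almost surely, since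
    integrability of [J (X n.+1)] makes the kernel integral finite almost surely. *)
Lemma cexp_tower n C (J : S -> R) : (n < N)%N -> past n C ->
  measurable_fun setT J -> (forall y, 0 <= J y) -> sqint Q (J \o X n.+1) ->
  (\int[Q]_w ((\1_C w)%:E * (J (X n.+1 w))%:E) =
   \int[Q]_w ((\1_C w)%:E * (cexp n J (X n w))%:E))%E.
Proof.
move=> nN pC mJ J0 sJ; have mC := past_measurable pC.
have mJE : measurable_fun setT (fun y => (J y)%:E : \bar R) by exact/measurable_EFinP.
have JE0 y : (0 <= (J y)%:E)%E by rewrite lee_fin.
have mK : measurable_fun setT (fun w => \int[kap n (X n w)]_y (J y)%:E)%E.
  exact: measurableT_comp (measurable_kernel_integral _ mJE JE0) (mX n).
rewrite (markov_integral nN pC mJE JE0).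
have m1 : measurable_fun setT (fun w => (\1_C w)%:E : \bar R).
  exact/measurable_EFinP/measurable_indic.
apply: ge0_ae_eq_integral => //.
- exact: emeasurable_funM.
- apply: emeasurable_funM => //; apply/measurable_EFinP.
  exact: measurableT_comp (measurable_cexp n mJ J0) (mX n).
- by move=> w _; rewrite mule_ge0 ?lee_fin// integral_ge0.
- by move=> w _; rewrite mule_ge0 ?lee_fin// cexp_ge0.
have iK : Q.-integrable setT (fun w => \int[kap n (X n w)]_y (J y)%:E)%E.
  apply/integrableP; split => //.
  have /integrableP[_] := sqint_integrable sJ; apply: le_lt_trans.
  have := markov_integral nN (pastT n) mJE JE0.
  under eq_integral do rewrite indicT mul1e.
  under [in RHS]eq_integral do rewrite indicT mul1e.
  move=> h.
  under eq_integral do rewrite gee0_abs ?integral_ge0//.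
  rewrite -h; apply: ge0_le_integral => //.
  - exact: measurableT_comp mJE (mX n.+1).
  - by apply/measurableT_comp => //; exact: measurableT_comp mJE (mX n.+1).
  - by move=> w _; rewrite /= lee_fin ler_norm.
apply: filterS (integrable_ae measurableT iK) => w /(_ Logic.I) fin _.
by rewrite /cexp fineK.
Qed.

End MarkovProcess.

(** * The two algorithms along paths *)

Section PathRecursion.
Context {R : realType} (d N K : nat).
Local Notation S := (d.-tuple R).
Variables (g : S -> R) (alpha : R) (sig : R -> R).
Variables (alp : 'I_K -> S) (bet : 'I_K -> R).
Hypothesis g_ge0 : forall y, 0 <= g y.
Hypothesis alpha_gt0 : 0 < alpha.
Hypothesis mg : measurable_fun setT g.
Hypothesis msig : measurable_fun setT sig.

Definition feature (k : 'I_K) (y : S) : R := sig (dotp (alp k) y + bet k).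

Lemma measurable_feature k : measurable_fun setT (feature k).
Proof.
apply: measurableT_comp => //; apply: measurable_funD => //.
apply: measurable_sum => j; apply: measurable_funM => //.
exact: measurable_tnth.
Qed.

Lemma measurable_Phi th : measurable_fun setT (Phi sig alp bet th).
Proof.
by apply: measurable_sum => k; apply: measurable_funM => //; exact: measurable_feature.
Qed.

(** The discounted sum of all payoffs from date [N - k] on. It dominates the value of every stopping
    rule whatever the coefficients, so it is a common bound for ideal and fitted values. *)
Fixpoint envelope (z : nat -> S) (k : nat) : R :=
  match k with
  | 0 => g (z N)
  | k'.+1 => g (z (N - k'.+1)%N) + alpha * envelope z k'
  end.

Lemma envelope_ge0 z k : 0 <= envelope z k.
Proof.
by elim: k => [|k IHk] //=; rewrite addr_ge0// mulr_ge0// ltW.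
Qed.

Lemma paux_bounds y th k i :
  0 <= paux N g alpha sig alp bet y th k i <= envelope (y i) k.
Proof.
elim: k => [|k /andP[IH0 IHk]] /=; first by rewrite g_ge0 lexx.
have e0 := envelope_ge0 (y i) k; have a0 := ltW alpha_gt0.
case: ifP => _; first by rewrite g_ge0 lerDl mulr_ge0.
by rewrite mulr_ge0//= ler_wpDl// ler_wpM2l.
Qed.

(** The recursion reads no date before [N - k]; for [k < N] a value can therefore be computed from a
    sample path, which holds the dates 1 to [N] only. *)
Lemma eq_paux y y' th k i i' :
  (forall n, (N - k <= n <= N)%N -> y i n = y' i' n) ->
  paux N g alpha sig alp bet y th k i = paux N g alpha sig alp bet y' th k i'.
Proof.
elim: k => [|k IHk] yy' /=; first by rewrite yy'// subn0 leqnn.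
rewrite yy' ?leqnn ?leq_subr// IHk// => n /andP[kn nN].
by apply: yy'; rewrite nN andbT (leq_trans _ kn)// leq_sub2l.
Qed.

Lemma eq_envelope z z' k : (forall n, (N - k <= n <= N)%N -> z n = z' n) ->
  envelope z k = envelope z' k.
Proof.
elim: k => [|k IHk] zz' /=; first by rewrite zz'// subn0 leqnn.
rewrite zz' ?leqnn ?leq_subr// IHk// => n /andP[kn nN].
by apply: zz'; rewrite nN andbT (leq_trans _ kn)// leq_sub2l.
Qed.

(** The implementable recursion on one path, placed in a constant family and read at index 0.
    Sharing [paux] makes its bounds and its locality available for ideal and fitted coefficients
    alike. *)
Definition pathval (theta : nat -> 'I_K -> R) (k : nat) (z : nat -> S) : R :=
  paux N g alpha sig alp bet (fun=> z) theta k 0.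

Lemma measurable_pathval dT (T : measurableType dT) (Z : nat -> T -> S) theta k :
  (forall n, measurable_fun setT (Z n)) ->
  measurable_fun setT (fun t => pathval theta k (Z ^~ t)).
Proof.
move=> mZ; elim: k => [|k IHk]; first exact: measurableT_comp mg (mZ N).
rewrite /pathval /=; apply: measurable_fun_ifT.
- apply: measurable_fun_ler; last exact: measurableT_comp mg (mZ _).
  apply: measurable_funM => //.
  exact: measurableT_comp (measurable_Phi _) (mZ _).
- exact: measurableT_comp mg (mZ _).
- by apply: measurable_funM.
Qed.

Lemma measurable_envelope dT (T : measurableType dT) (Z : nat -> T -> S) k :
  (forall n, measurable_fun setT (Z n)) ->
  measurable_fun setT (fun t => envelope (Z ^~ t) k).
Proof.
move=> mZ; elim: k => [|k IHk] /=; first exact: measurableT_comp mg (mZ N).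
apply: measurable_funD; first exact: measurableT_comp mg (mZ _).
exact: measurable_funM.
Qed.

End PathRecursion.

(** * Conditional values and residuals of the ideal rule *)

Section IdealizedAlgorithm.
Context {R : realType} (d N K : nat).
Local Notation S := (d.-tuple R).
Context {dO : measure_display} {Om : measurableType dO}.
Variables (Q : probability Om R) (X : nat -> Om -> S) (x0 : S).
Variables (kap : nat -> R.-pker S ~> S).
Variables (g : S -> R) (alpha : R) (sig : R -> R).
Variables (alp : 'I_K -> S) (bet : 'I_K -> R) (theta : nat -> 'I_K -> R).
Variable M : R.
Hypothesis mX : forall n, measurable_fun setT (X n).
Hypothesis markov : forall n (B : nat -> set S) (A : set S),
  (n < N)%N -> (forall j, measurable (B j)) -> measurable A ->
  Q ((\bigcap_(j in [set j | (j <= n)%N]) (X j @^-1` B j)) `&` (X n.+1 @^-1` A))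
  = (\int[Q]_(w in \bigcap_(j in [set j | (j <= n)%N]) (X j @^-1` B j))
       kap n (X n w) A)%E.
Hypothesis mg : measurable_fun setT g.
Hypothesis g_ge0 : forall y, 0 <= g y.
Hypothesis g_sqint : forall n, (n <= N)%N ->
  Q.-integrable setT (fun w => ((g (X n w)) ^+ 2)%:E).
Hypothesis alpha_gt0 : 0 < alpha.
Hypothesis msig : measurable_fun setT sig.
Hypothesis sigM : forall t, `|sig t| <= M.

Local Notation V := (Paux N kap g alpha sig alp bet theta).
Local Notation q := (pathval N g alpha sig alp bet theta).
Local Notation feature := (feature sig alp bet).

Lemma sqint_gX n : (n <= N)%N -> sqint Q (g \o X n).
Proof. by move=> nN; split; [exact: measurableT_comp|exact: g_sqint]. Qed.

Lemma sqint_envelope k : (k <= N)%N ->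
  sqint Q (fun w => envelope N g alpha (X ^~ w) k).
Proof.
elim: k => [|k IHk] kN; first exact: sqint_gX.
apply: sqintD; first by apply: sqint_gX; exact: leq_subr.
by apply: sqintZ; apply: IHk; exact: ltnW.
Qed.

Lemma sqint_pathval k : (k <= N)%N -> sqint Q (fun w => q k (X ^~ w)).
Proof.
move=> kN; apply: sqint_le (sqint_envelope kN); first exact: measurable_pathval.
move=> w; have /andP[h0 h1] := paux_bounds N sig alp bet g_ge0 alpha_gt0
  (fun=> X ^~ w) theta k 0.
by rewrite !ger0_norm// (le_trans h0).
Qed.

Lemma Paux_ge0 k y : 0 <= V k y.
Proof.
elim: k y => [|k IHk] y //=; case: ifP => _ //.
by apply: mulr_ge0; [exact: ltW|exact: (cexp_ge0 kap _ _ IHk)].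
Qed.

Lemma measurable_Paux k : measurable_fun setT (V k).
Proof.
elim: k => [|k IHk] //=; apply: measurable_fun_ifT => //.
  apply: measurable_fun_ler => //; apply: measurable_funM => //.
  exact: measurable_Phi.
apply: measurable_funM => //.
exact: (measurable_cexp kap _ IHk (Paux_ge0 k)).
Qed.

Lemma sqint_Paux k : (k <= N)%N -> sqint Q (V k \o X (N - k)%N).
Proof.
elim: k => [|k IHk] kN; first by rewrite subn0; exact: sqint_gX.
have nN : (N - k.+1 < N)%N by rewrite ltn_subrL (leq_ltn_trans _ kN).
have sc : sqint Q (cexp kap (N - k.+1) (V k) \o X (N - k.+1)%N).
  apply: (sqint_cexp mX markov nN (measurable_Paux k) (Paux_ge0 k)).
  by rewrite subnSK//; apply: IHk; exact: ltnW.
apply: sqint_le (sqintD (sqint_gX (ltnW nN)) (sqintZ alpha sc)).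
  exact: measurableT_comp (measurable_Paux k.+1) (mX _).
move=> w /=; have c0 := cexp_ge0 kap (N - k.+1) (X (N - k.+1)%N w) (Paux_ge0 k).
have ac0 := mulr_ge0 (ltW alpha_gt0) c0.
have g0 := g_ge0 (X (N - k.+1)%N w).
rewrite (ger0_norm (addr_ge0 g0 ac0)); case: ifP => _.
  by rewrite ger0_norm// lerDl.
by rewrite ger0_norm ?lerDr.
Qed.

(** Backward induction with [C] left arbitrary. The decision at date [N - k.+1] splits [C] into [C1]
    (stop), where both sides are [g], and [C0] (continue), again a past event, where the induction
    hypothesis at the next date is followed by [cexp_tower]. *)
Lemma pathval_tower k C : (k <= N)%N -> past X (N - k) C ->
  (\int[Q]_w ((\1_C w)%:E * (q k (X ^~ w))%:E) =
   \int[Q]_w ((\1_C w)%:E * (V k (X (N - k)%N w))%:E))%E.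
Proof.
elim: k C => [|k IHk] C kN pC.
  by apply: eq_integral => w _; rewrite subn0.
set n := (N - k.+1)%N in pC *.
have nN : (n < N)%N by rewrite ltn_subrL (leq_ltn_trans _ kN).
have nS : n.+1 = (N - k)%N by rewrite /n subnSK.
have mC := past_measurable mX pC.
pose D y := alpha * Phi sig alp bet (theta n) y <= g y.
have mDb : measurable_fun setT D.
  apply: measurable_fun_ler => //; apply: measurable_funM => //.
  exact: measurable_Phi.
have mD b : measurable (D @^-1` [set b]).
  by rewrite -[_ @^-1` _]setTI; exact: mDb.
pose C1 := C `&` X n @^-1` (D @^-1` [set true]).
pose C0 := C `&` X n @^-1` (D @^-1` [set false]).
have pC1 : past X n C1 by exact: pastI.
have pC0 : past X n C0 by exact: pastI.
have mC1 := past_measurable mX pC1.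
have mC0 := past_measurable mX pC0.
have indD w : \1_C1 w = \1_C w * (D (X n w))%:R :> R.
  rewrite /C1 indicI /=; congr (_ * _); rewrite indicE; congr ((nat_of_bool _)%:R).
  by apply/idP/idP; rewrite inE /preimage/=; case: (D _).
have indD' w : \1_C0 w = \1_C w * (~~ D (X n w))%:R :> R.
  rewrite /C0 indicI /=; congr (_ * _); rewrite indicE; congr ((nat_of_bool _)%:R).
  by apply/idP/idP; rewrite inE /preimage/=; case: (D _).
have split_int (f h : Om -> R) : measurable_fun setT h -> (forall w, 0 <= h w) ->
    (forall w, f w = if D (X n w) then g (X n w) else alpha * h w) ->
    (\int[Q]_w ((\1_C w)%:E * (f w)%:E) =
     \int[Q]_w ((\1_C1 w)%:E * (g (X n w))%:E) +
     alpha%:E * \int[Q]_w ((\1_C0 w)%:E * (h w)%:E))%E.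
  move=> mh h0 fE.
  have mI (E : set Om) (u : Om -> R) : measurable E -> measurable_fun setT u ->
      measurable_fun setT (fun w => ((\1_E w)%:E * (u w)%:E)%E).
    move=> mE mu; apply: emeasurable_funM; apply/measurable_EFinP => //.
  have mgX : measurable_fun setT (g \o X n) by exact: measurableT_comp.
  rewrite -ge0_integralZl_EFin//; last 3 first.
  - by move=> w _; rewrite mule_ge0 ?lee_fin.
  - exact: mI.
  - exact: ltW.
  rewrite -ge0_integralD//; last 4 first.
  - by move=> w _; rewrite mule_ge0 ?lee_fin.
  - exact: mI.
  - by move=> w _; rewrite !mule_ge0 ?lee_fin// ltW.
  - by apply: measurable_funeM; exact: mI.
  apply: eq_integral => w _; rewrite indD indD' fE -!EFinM -EFinD.
  by case: (D _) => /=; congr (_%:E); ring.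
rewrite (@split_int (fun w => q k.+1 (X ^~ w)) (fun w => q k (X ^~ w)))//; last 2 first.
- exact: measurable_pathval.
- by move=> w; have /andP[] := paux_bounds N sig alp bet g_ge0 alpha_gt0
    (fun=> X ^~ w) theta k 0.
rewrite (@split_int (fun w => V k.+1 (X n w)) (fun w => cexp kap n (V k) (X n w)))//; last 2 first.
- by apply: measurableT_comp => //; exact: (measurable_cexp kap _ (measurable_Paux k) (Paux_ge0 k)).
- by move=> w; exact: (cexp_ge0 kap n _ (Paux_ge0 k)).
congr (_ + _ * _)%E; rewrite IHk; last 2 first.
- exact: ltnW.
- by rewrite -nS; exact: pastS.
rewrite -nS; apply: (cexp_tower mX markov nN pC0 (measurable_Paux k) (Paux_ge0 k)).
by rewrite nS; apply: sqint_Paux; exact: ltnW.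
Qed.

Section OneStep.
Variable n : nat.
Hypothesis nN : (n < N)%N.
Local Notation k := (N - n.+1)%N.
Local Notation cond := (cexp kap n (V k) \o X n).

Let kN : (k <= N)%N. Proof. exact: leq_subr. Qed.
Let Nk : (N - k)%N = n.+1. Proof. by rewrite subKn. Qed.

Lemma sqint_cond : sqint Q cond.
Proof.
apply: (sqint_cexp mX markov nN (measurable_Paux _) (Paux_ge0 _)).
by rewrite -[in X n.+1]Nk; exact: sqint_Paux.
Qed.

Lemma cond_pathval_ge0 (psi : S -> R) : measurable_fun setT psi ->
  (forall y, 0 <= psi y) ->
  (\int[Q]_w ((q k (X ^~ w))%:E * (psi (X n w))%:E) =
   \int[Q]_w ((cond w)%:E * (psi (X n w))%:E))%E.
Proof.
move=> mpsi psi0.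
have q0 w : 0 <= q k (X ^~ w).
  by have /andP[] := paux_bounds N sig alp bet g_ge0 alpha_gt0
    (fun=> X ^~ w) theta k 0.
have c0 w : 0 <= cond w by exact: (cexp_ge0 kap n _ (Paux_ge0 k)).
have mq : measurable_fun setT (fun w => q k (X ^~ w)) by exact: measurable_pathval.
have mc : measurable_fun setT cond := sqint_measurable sqint_cond.
have mE : measurable_fun setT (EFin \o psi) by exact/measurable_EFinP.
have E0 y : (0 <= (EFin \o psi) y)%E by rewrite lee_fin.
have := @eq_mono_linear R _ S _ _
  (@mono_linear_integral_comp R _ _ _ _ Q _ _ (mX n) mq q0)
  (@mono_linear_integral_comp R _ _ _ _ Q _ _ (mX n) mc c0).
move=> /(_ _ (EFin \o psi) mE E0); apply => A mA.
have pA : past X n (X n @^-1` A) by rewrite -(setTI (_ @^-1` _)); exact: pastI (pastT X n) mA.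
have := pathval_tower kN (C := X n @^-1` A).
rewrite Nk => /(_ (pastS pA)).
have sV : sqint Q (V k \o X n.+1) by rewrite -[in X n.+1]Nk; exact: sqint_Paux.
rewrite (cexp_tower mX markov nN pA (measurable_Paux k) (Paux_ge0 k) sV) => h.
under eq_integral do rewrite muleC.
under [in RHS]eq_integral do rewrite muleC.
exact: h.
Qed.

(** Monotone functionals only see nonnegative test functions; a bounded signed [psi] is shifted by
    [L] and the constant part subtracted afterwards. *)
Lemma cond_pathval (psi : S -> R) (L : R) : measurable_fun setT psi ->
  (forall y, `|psi y| <= L) ->
  \int[Q]_w (q k (X ^~ w) * psi (X n w)) = \int[Q]_w (cond w * psi (X n w)).
Proof.
move=> mpsi psiL.
have pos y : 0 <= psi y + L by have := psiL y; rewrite ler_norml; lra.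
have L0 : 0 <= L by exact: le_trans (normr_ge0 _) (psiL point).
have sq := sqint_pathval kN; have sc := sqint_cond.
have shift (f : Om -> R) : sqint Q f ->
    \int[Q]_w (f w * psi (X n w)) =
    \int[Q]_w (f w * (psi (X n w) + L)) - \int[Q]_w (f w * L).
  move=> sf; rewrite -RintegralB//.
  - by apply: eq_Rintegral => w _; ring.
  - apply: sqint_mul => //.
    apply: (@sqint_bounded _ _ _ Q _ (L + L)).
      by apply: measurable_funD => //; exact: measurableT_comp.
    move=> w; rewrite (le_trans (ler_normD _ _))// lerD// ger0_norm//.
  - by apply: sqint_mul => //; exact: sqint_cst.
have e (u : S -> R) : measurable_fun setT u -> (forall y, 0 <= u y) ->
    \int[Q]_w (q k (X ^~ w) * u (X n w)) = \int[Q]_w (cond w * u (X n w)).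
  move=> mu u0; rewrite /Rintegral; congr fine.
  have := cond_pathval_ge0 mu u0.
  move=> h; under eq_integral do rewrite EFinM.
  by under [in RHS]eq_integral do rewrite EFinM.
rewrite (shift _ sq) (shift _ sc) (e (fun y => psi y + L))//.
  by rewrite (e (fun=> L)).
exact: measurable_funD.
Qed.

Hypothesis theta_min : forall th : 'I_K -> R,
  (l2sq Q X n (fun x => (cexp kap n (V k) x - Phi sig alp bet (theta n) x)%R)
   <= l2sq Q X n (fun x => (cexp kap n (V k) x - Phi sig alp bet th x)%R))%E.

Lemma sqint_feature j : sqint Q (feature j \o X n).
Proof.
apply: (@sqint_bounded _ _ _ Q _ M).
  by apply: measurableT_comp => //; exact: measurable_feature.
by move=> w; exact: sigM.
Qed.

Lemma sqint_Phi th : sqint Q (Phi sig alp bet th \o X n).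
Proof. by apply: sqint_sum => j; apply: sqintZ; exact: sqint_feature. Qed.

(** Since [theta n] projects the conditional value, that residual is orthogonal to the features. A
    feature at [X n] is a function of date [n] alone, so the pathwise value may stand in for the
    conditional one. *)
Lemma ideal_residual_orthogonal j :
  \int[Q]_w ((q k (X ^~ w) - Phi sig alp bet (theta n) (X n w)) *
             feature j (X n w)) = 0.
Proof.
have sc := sqint_cond; have sP := sqint_Phi (theta n).
have sf := sqint_feature j; have sq := sqint_pathval kN.
have -> : \int[Q]_w ((q k (X ^~ w) - Phi sig alp bet (theta n) (X n w)) *
             feature j (X n w)) =
    \int[Q]_w ((cond w - Phi sig alp bet (theta n) (X n w)) * feature j (X n w)).
  under eq_Rintegral do rewrite mulrBl.
  under [RHS]eq_Rintegral do rewrite mulrBl.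
  rewrite RintegralB//; [|exact: sqint_mul sq sf|exact: sqint_mul sP sf].
  rewrite RintegralB//; [|exact: sqint_mul sc sf|exact: sqint_mul sP sf].
  rewrite (@cond_pathval _ M)//; first exact: measurable_feature.
  by move=> y; exact: sigM.
apply: least_squares_orthogonal (sqintB sc sP) sf _ => t.
pose th i := theta n i + t * (i == j)%:R.
have thE y : Phi sig alp bet th y = Phi sig alp bet (theta n) y + t * feature j y.
  rewrite /Phi /th; under eq_bigr do rewrite mulrDl.
  rewrite big_split/=; congr (_ + _); rewrite (bigD1 j)//= eqxx mulr1.
  by rewrite big1 ?addr0// => i /negbTE ->; rewrite mulr0 mul0r.
have sP2 := sqint_Phi th.
have := theta_min th; rewrite /l2sq -!EFin_Rintegral; last 2 first.
- exact: (sqintB sc sP2).2.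
- exact: (sqintB sc sP).2.
rewrite lee_fin => /le_trans; apply; rewrite le_eqVlt; apply/orP; left.
by apply/eqP; apply: eq_Rintegral => w _; rewrite thE /=; congr (_ ^+ 2); ring.
Qed.

End OneStep.

(** Dominated convergence under the envelope: off the tie set the margin is positive, so the
    indicator is eventually 0. *)
Lemma no_tie_margin_cvg n k : (k <= N)%N ->
  Q [set w | alpha * Phi sig alp bet (theta n) (X n w) = g (X n w)] = 0%E ->
  (fun l => \int[Q]_w (envelope N g alpha (X ^~ w) k *
     (`|alpha * Phi sig alp bet (theta n) (X n w) - g (X n w)|
        <= l.+1%:R^-1)%R%:R)) @ \oo --> (0 : R).
Proof.
move=> kN tie.
pose mar w := `|alpha * Phi sig alp bet (theta n) (X n w) - g (X n w)|.
have mmar : measurable_fun setT mar.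
  apply: measurableT_comp => //; apply: measurable_funB.
    by apply: measurable_funM => //; exact: measurableT_comp (measurable_Phi _ _ msig _) (mX n).
  exact: measurableT_comp.
pose e w := envelope N g alpha (X ^~ w) k.
have se : sqint Q e := sqint_envelope kN.
have e0 w : 0 <= e w by exact: envelope_ge0.
pose f l w := (e w * (mar w <= l.+1%:R^-1)%R%:R).
have mf l : measurable_fun setT (f l).
  apply: measurable_funM; first exact: sqint_measurable se.
  have -> : (fun w => (mar w <= l.+1%:R^-1)%R%:R) =
     (fun w => if mar w <= l.+1%:R^-1 then 1 else 0) :> (Om -> R).
    by apply/funext => w; case: ifP.
  by apply: measurable_fun_ifT => //; exact: measurable_fun_ler.
have lim0 : {ae Q, forall w, setT w -> (EFin \o f ^~ w) @ \oo --> 0%E}.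
  exists [set w | mar w = 0]; split.
  - rewrite (_ : [set _ | _] = mar @^-1` [set 0]) //.
    by rewrite -[_ @^-1` _]setTI; exact: mmar.
  - rewrite -tie; congr (Q _); apply/seteqP; split => w /=.
      by move=> /eqP; rewrite normr_eq0 subr_eq0 => /eqP.
    by rewrite /mar => ->; rewrite subrr normr0.
  - move=> w /=; apply: contra_notP => /eqP mar0 _.
    have mp : 0 < mar w by rewrite lt_def mar0 normr_ge0.
    apply: cvg_near_cst; near=> l; rewrite /f /= (_ : (mar w <= _) = false) ?mulr0//.
    apply/negbTE; rewrite -ltNge; near: l.
    have := @cvg_harmonic R; move/cvgr0Pnorm_lt => /(_ _ mp); apply: filterS => l.
    by rewrite /= ger0_norm.
have fe : {ae Q, forall w l, setT w -> (`|(f l w)%:E| <= (EFin \o e) w)%E}.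
  apply: aeW => w l _; rewrite /= lee_fin ger0_norm ?mulr_ge0//.
  by rewrite ler_piMr// lern1 leq_b1.
have [_ _] := @dominated_convergence _ _ _ Q setT measurableT
  (fun l w => (f l w)%:E) (cst 0%E) (EFin \o e)
  (fun l => (measurable_EFinP _ _).2 (mf l)) (measurable_cst _) lim0
  (sqint_integrable se) fe.
rewrite integral0 => /fine_cvgP[_].
exact.
Unshelve. all: by end_near. Qed.

(** Conditioning at date 0 is trivial because [X 0] is constant, so [cond_pathval_ge0] with the test
    function 1 is already the claim. *)
Lemma Rintegral_pathval1 : (0 < N)%N -> (forall w, X 0%N w = x0) ->
  \int[Q]_w q (N - 1) (X ^~ w) = cexp kap 0 (V (N - 1)) x0.
Proof.
move=> N0 X0.
rewrite -[RHS](Rintegral_cst1 Q); rewrite /Rintegral; congr fine.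
have h := cond_pathval_ge0 N0 (psi := cst 1) (measurable_cst _) (fun=> ler01).
under eq_integral do rewrite -[X in X%:E]mulr1 EFinM.
rewrite h; apply: eq_integral => w _; rewrite /cst mule1 /= X0.
by [].
Qed.

End IdealizedAlgorithm.

(** * Averages and regression along the sampled paths *)

Section ImplementableAlgorithm.
Context {R : realType} (d N K : nat).
Local Notation S := (d.-tuple R).
Context {dO : measure_display} {Om : measurableType dO}.
Variables (Q : probability Om R) (X : nat -> Om -> S) (x0 : S).
Variables (g : S -> R) (alpha : R) (sig : R -> R).
Variables (alp : 'I_K -> S) (bet : 'I_K -> R) (theta : nat -> 'I_K -> R).
Variable M : R.
Hypothesis mX : forall n, measurable_fun setT (X n).
Hypothesis mg : measurable_fun setT g.
Hypothesis g_ge0 : forall y, 0 <= g y.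
Hypothesis g_sqint : forall n, (n <= N)%N ->
  Q.-integrable setT (fun w => ((g (X n w)) ^+ 2)%:E).
Hypothesis alpha_gt0 : 0 < alpha.
Hypothesis msig : measurable_fun setT sig.
Hypothesis sigM : forall t, `|sig t| <= M.
Context {dS : measure_display} {Sm : measurableType dS} (P : probability Sm R).
Variable Y : nat -> Sm -> nat -> S.
Variable thhat : nat -> Sm -> nat -> 'I_K -> R.
Hypothesis mY : forall i n, (1 <= n <= N)%N ->
  measurable_fun setT (fun w => Y i w n).
Hypothesis Y_iid : forall (s : seq nat) (B : nat -> set (N.-tuple S)),
  uniq s -> (forall i, measurable (B i)) ->
  P (\bigcap_(i in [set` s]) (samplepath N (fun n w => Y i w n) @^-1` B i))
  = (\prod_(i <- s) Q (samplepath N X @^-1` B i))%E.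

Local Notation U := (N.-tuple S).
Local Notation q := (pathval N g alpha sig alp bet theta).
Local Notation feature := (feature sig alp bet).
Local Notation Wpath i := (samplepath N (fun n w => Y i w n)).

(* Dates start at [1] in a sample path, so the entry at date [0] is junk. *)
Definition path_at (n : nat) (t : U) : S := nth x0 t n.-1.

Lemma path_atE (T : Type) (Z : nat -> T -> S) n w : (1 <= n <= N)%N ->
  path_at n (samplepath N Z w) = Z n w.
Proof.
case: n => // n /andP[_ nN]; rewrite /path_at /=.
by rewrite -(tnth_nth x0 (samplepath N Z w) (Ordinal nN)) tnth_mktuple.
Qed.

Lemma measurable_path_at n : measurable_fun setT (path_at n).
Proof.
have [nN|Nn] := ltnP n.-1 N.
  have -> : path_at n = (@tnth N S)^~ (Ordinal nN).
    by apply/funext => t; rewrite (tnth_nth x0).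
  exact: measurable_tnth.
have -> : path_at n = cst x0.
  by apply/funext => t; rewrite /path_at nth_default// size_tuple.
exact: measurable_cst.
Qed.

Lemma measurable_samplepath d' (T : measurableType d') (Z : nat -> T -> S) :
  (forall n, (1 <= n <= N)%N -> measurable_fun setT (Z n)) ->
  measurable_fun setT (samplepath N Z).
Proof.
move=> mZ; apply/measurable_fun_tnthP => j.
have -> : (fun t : U => tnth t j) \o samplepath N Z = Z j.+1.
  by apply/funext => w /=; rewrite tnth_mktuple.
by apply: mZ; rewrite /= ltn_ord.
Qed.

Let mXp : measurable_fun setT (samplepath N X).
Proof. exact: measurable_samplepath. Qed.

Let mYp i : measurable_fun setT (Wpath i).
Proof. by apply: measurable_samplepath => n nN; exact: mY. Qed.

Let Y_law i (A : set U) : measurable A ->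
  P (Wpath i @^-1` A) = Q (samplepath N X @^-1` A).
Proof.
move=> mA; have := Y_iid (s := [:: i]) (B := fun=> A) isT (fun=> mA).
rewrite big_seq1 => <-; congr (P _); apply/seteqP; split => w.
  by move=> wA j /=; rewrite inE => /eqP ->.
by move=> /(_ i) /=; rewrite inE eqxx => /(_ isT).
Qed.

Let Y_pair i j (A B : set U) : i != j -> measurable A -> measurable B ->
  P (Wpath i @^-1` A `&` Wpath j @^-1` B) =
  (Q (samplepath N X @^-1` A) * Q (samplepath N X @^-1` B))%E.
Proof.
move=> ij mA mB.
have ji : (j == i) = false by rewrite eq_sym (negbTE ij).
have -> : Wpath i @^-1` A `&` Wpath j @^-1` B =
    \bigcap_(l in [set` [:: i; j]]) (Wpath l @^-1` (if l == i then A else B)).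
  apply/seteqP; split => w.
    move=> [wA wB] l /=; rewrite !inE => /orP[/eqP->|/eqP->].
      by rewrite eqxx.
    by rewrite ji.
  move=> h; split.
    by have := h i; rewrite /= !inE !eqxx => /(_ isT).
  by have := h j; rewrite /= !inE eqxx orbT ji => /(_ isT).
rewrite (Y_iid (s := [:: i; j]) (B := fun l => if l == i then A else B)).
- by rewrite big_cons big_seq1 eqxx ji.
- by rewrite /= inE ij.
- by move=> l; case: ifP.
Qed.

(** [Y_iid] concerns tuples of the dates 1 to [N], while [F] reads whole sequences; the locality
    condition makes the remaining entries irrelevant. *)
Lemma path_slln (F : (nat -> S) -> R) :
  measurable_fun setT (fun t : U => F (path_at ^~ t)) ->
  (forall z z', (forall n, (1 <= n <= N)%N -> z n = z' n) -> F z = F z') ->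
  sqint Q (fun w => F (X ^~ w)) ->
  {ae P, forall s, mean n (fun i => F (Y i s)) @[n --> \oo] -->
     (\int[Q]_w F (X ^~ w) : R)}.
Proof.
move=> mF Floc sF.
have FX w : F (path_at ^~ (samplepath N X w)) = F (X ^~ w).
  by apply: Floc => n nN; rewrite path_atE.
have FY i s : F (path_at ^~ (Wpath i s)) = F (Y i s).
  by apply: Floc => n nN; rewrite path_atE.
have sF' : sqint Q ((fun t : U => F (path_at ^~ t)) \o samplepath N X).
  by rewrite (_ : _ \o _ = fun w => F (X ^~ w))//; apply/funext => w /=; rewrite FX.
have := slln_samples mXp mYp Y_law Y_pair mF sF'.
under [in X in X -> _]eq_Rintegral do rewrite FX.
apply: filterS => s; apply: cvg_trans; apply: near_eq_cvg; apply: nearW => n.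
by rewrite /mean; congr (_ * _); apply: eq_bigr => i _; rewrite FY.
Qed.

(** A null set of the law of [X n] is avoided by countably many samples at once; this moves the
    almost everywhere relations of [gram_schmidt] to the sample points. *)
Lemma path_ae (h : S -> R) n : (1 <= n <= N)%N -> measurable_fun setT h ->
  {ae Q, forall w, h (X n w) = 0} -> {ae P, forall s i, h (Y i s n) = 0}.
Proof.
move=> nN mh h0.
pose C := [set t : U | h (path_at n t) != 0].
have mC : measurable C.
  rewrite (_ : C = (fun t => h (path_at n t)) @^-1` (~` [set 0])).
    rewrite -[_ @^-1` _]setTI; apply: (measurableT_comp mh (measurable_path_at n)) => //.
    exact: measurableC.
  by apply/seteqP; split => t /= /eqP.
have C0 : Q (samplepath N X @^-1` C) = 0%E.
  apply/negligibleP; first by rewrite -[_ @^-1` _]setTI; exact: mXp.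
  apply: negligibleS h0 => w /=; rewrite /C /= path_atE//.
  by move=> /eqP.
apply: filterS (sample_ae mYp Y_law mC C0) => s h1 i.
by apply/eqP/negP => h2; apply: (h1 i); rewrite /C /= path_atE//; exact/negP.
Qed.

Hypothesis thhat_min : forall m w n, (1 <= n < N)%N -> forall th : 'I_K -> R,
  emp_loss N g alpha sig alp bet (fun i k => Y i w k) (thhat m w) m n (thhat m w n)
  <= emp_loss N g alpha sig alp bet (fun i k => Y i w k) (thhat m w) m n th.

Definition pathval_error (s : Sm) (k m : nat) : R :=
  mean m (fun i => `|paux N g alpha sig alp bet (fun i k => Y i s k)
                        (thhat m s) k i - q k (Y i s)|).

(** The bound [k.+1 < N] keeps the date [n] at least 1, hence sampled. Convergence at the later date
    is a premise inside the almost sure statement, because the regression argument runs at a fixed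
    outcome [s]. *)
Lemma pathval_error_step k : (k.+1 < N)%N ->
  (forall j, \int[Q]_w ((q k (X ^~ w) -
      Phi sig alp bet (theta (N - k.+1)) (X (N - k.+1)%N w)) *
      feature j (X (N - k.+1)%N w)) = 0) ->
  Q [set w | alpha * Phi sig alp bet (theta (N - k.+1)) (X (N - k.+1)%N w) =
             g (X (N - k.+1)%N w)] = 0%E ->
  {ae P, forall s, pathval_error s k m @[m --> \oo] --> (0 : R) ->
                   pathval_error s k.+1 m @[m --> \oo] --> (0 : R)}.
Proof.
set n := (N - k.+1)%N => kN orth tie.
have n1 : (1 <= n <= N)%N by rewrite subn_gt0 kN leq_subr.
have n1' : (1 <= n < N)%N by rewrite subn_gt0 kN ltn_subrL (leq_ltn_trans _ kN).
have k1N : (k.+1 <= N)%N := ltnW kN.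
have kN' : (k <= N)%N := ltnW k1N.
have inside k' : (k' <= k.+1)%N -> forall z z' : nat -> S,
    (forall l, (1 <= l <= N)%N -> z l = z' l) ->
    forall l, (N - k' <= l <= N)%N -> z l = z' l.
  move=> k'k z z' zz' l /andP[h1 h2]; apply: zz'; rewrite h2 andbT.
  by apply: leq_trans h1; rewrite subn_gt0 (leq_ltn_trans k'k).
have sfeat j : sqint Q (feature j \o X n).
  apply: (@sqint_bounded _ _ _ Q _ M); last by move=> w; exact: sigM.
  by apply: measurableT_comp => //; exact: measurable_feature.
have [r [psi' [a [c [psi'E orthn phiE]]]]] := gram_schmidt sfeat.
(* The vectors [psi'] live on the space of [X]; the regression evaluates them at sampled states, so
   they are redefined on states with the same coefficients. *)
pose psi j y := \sum_i a j i * feature i y.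
have psiE j w : psi' j w = psi j (X n w) by rewrite psi'E.
have mpsi j : measurable_fun setT (psi j).
  apply: measurable_sum => i; apply: measurable_funM => //.
  exact: measurable_feature.
pose B := \sum_(j < r) \sum_i `|a j i| * M.
have M0 : 0 <= M := le_trans (normr_ge0 _) (sigM 0).
have psiB0 j y : `|psi j y| <= \sum_i `|a j i| * M.
  rewrite (le_trans (ler_norm_sum _ _ _))//; apply: ler_sum => i _.
  by rewrite normrM ler_wpM2l// sigM.
have psiB j y : (j < r)%N -> `|psi j y| <= B.
  move=> jr; apply: (le_trans (psiB0 j y)); rewrite /B (bigD1 (Ordinal jr))//=.
  by rewrite lerDl sumr_ge0// => i _; rewrite sumr_ge0// => l _; rewrite mulr_ge0.
have spsi j : sqint Q (psi j \o X n).
  apply: (@sqint_bounded _ _ _ Q _ (\sum_i `|a j i| * M)); last by move=> w; exact: psiB0.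
  exact: measurableT_comp.
have mat := measurable_path_at.
have ae_phi : {ae P, forall s, forall (i : 'I_K) l,
    feature i (Y l s n) = \sum_(j < r) c i j * psi j (Y l s n)}.
  have : forall i : 'I_K, {ae P, forall s, forall l,
      feature i (Y l s n) - \sum_(j < r) c i j * psi j (Y l s n) = 0}.
    move=> i; apply: (path_ae (h := fun y => feature i y - \sum_(j < r) c i j * psi j y)) => //.
      apply: measurable_funB; first exact: measurable_feature.
      by apply: measurable_sum => j; exact: measurable_funM.
    apply: filterS (phiE i) => w /= ->; apply/eqP; rewrite subr_eq0; apply/eqP.
    by apply: eq_bigr => j _; rewrite psiE.
  move=> h; apply: filter_forall => i; apply: filterS (h i) => s hs l.
  by apply/eqP; rewrite -subr_eq0; apply/eqP; exact: hs.
have ae_gram : {ae P, forall s, forall i j : 'I_r,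
    mean m (fun l => psi i (Y l s n) * psi j (Y l s n)) @[m --> \oo]
      --> ((i == j)%:R : R)}.
  apply: filter_forall => i; apply: filter_forall => j.
  have -> : (i == j)%:R = \int[Q]_w (psi i (X n w) * psi j (X n w)) :> R.
    rewrite -[LHS](orthn i j (ltn_ord i) (ltn_ord j)).
    by apply: eq_Rintegral => w _; rewrite !psiE.
  apply: (path_slln (F := fun z => psi i (z n) * psi j (z n))).
  - by apply: measurable_funM; apply: measurableT_comp (mat n).
  - by move=> z z' zz'; rewrite zz'.
  - apply: (sqintM_bounded (spsi i) (M := \sum_l `|a j l| * M)).
      exact: measurableT_comp.
    by move=> w; exact: psiB0.
have sq := sqint_pathval alp bet theta mX mg g_ge0 g_sqint alpha_gt0 msig kN'.
have sPhi : sqint Q (Phi sig alp bet (theta n) \o X n).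
  by apply: sqint_sum => j; apply: sqintZ; exact: sfeat.
have mPhi := measurable_Phi alp bet msig (theta n).
have ae_res : {ae P, forall s, forall j : 'I_r,
    mean m (fun l => (q k (Y l s) - Phi sig alp bet (theta n) (Y l s n)) *
       psi j (Y l s n)) @[m --> \oo] --> (0 : R)}.
  apply: filter_forall => j.
  have <- : \int[Q]_w ((q k (X ^~ w) - Phi sig alp bet (theta n) (X n w)) *
      psi j (X n w)) = 0.
    under eq_Rintegral do rewrite /psi mulr_sumr.
    rewrite (Rintegral_sum (mu := Q) (index_enum 'I_K) (f := fun i w =>
      (q k (X ^~ w) - Phi sig alp bet (theta n) (X n w)) *
      (a j i * feature i (X n w)))); last first.
      move=> i; apply: sqint_mul; first exact: sqintB.
      by have := sqintZ (a j i) (sfeat i).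
    rewrite big1// => i _; under eq_Rintegral do rewrite mulrCA.
    rewrite RintegralZ ?orth ?mulr0//; apply: sqint_mul (sfeat i).
    exact: sqintB.
  apply: (path_slln (F := fun z => (q k z - Phi sig alp bet (theta n) (z n)) *
      psi j (z n))).
  - apply: measurable_funM; last exact: measurableT_comp (mat n).
    apply: measurable_funB; last exact: measurableT_comp mPhi (mat n).
    exact: measurable_pathval.
  - move=> z z' zz'; rewrite zz'//; congr ((_ - _) * _).
    by apply: eq_paux; apply: (inside k (leqnSn k)).
  - apply: (sqintM_bounded (sqintB sq sPhi) (M := \sum_l `|a j l| * M)).
      exact: measurableT_comp.
    by move=> w; exact: psiB0.
pose mar y l : R := (`|alpha * Phi sig alp bet (theta n) y - g y| <= l.+1%:R^-1)%R%:R.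
have mmar l : measurable_fun setT (mar ^~ l).
  have -> : mar ^~ l = (fun y => if `|alpha * Phi sig alp bet (theta n) y - g y|
      <= l.+1%:R^-1 then 1 else 0).
    by apply/funext => y; rewrite /mar; case: ifP.
  apply: measurable_fun_ifT => //; apply: measurable_fun_ler => //.
  apply: measurableT_comp => //; apply: measurable_funB => //.
  exact: measurable_funM.
have mar1 y l : `|mar y l| <= 1.
  by rewrite /mar ger0_norm// lern1 leq_b1.
have senv := sqint_envelope alpha mX mg g_sqint k1N.
have ae_mar : {ae P, forall s, forall l,
    mean m (fun i => envelope N g alpha (Y i s) k.+1 * mar (Y i s n) l) @[m --> \oo]
    --> (\int[Q]_w (envelope N g alpha (X ^~ w) k.+1 * mar (X n w) l) : R)}.
  apply: (ae_foralln (P := fun l s => mean m (fun i =>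
    envelope N g alpha (Y i s) k.+1 * mar (Y i s n) l) @[m --> \oo]
    --> (\int[Q]_w (envelope N g alpha (X ^~ w) k.+1 * mar (X n w) l) : R))) => l.
  apply: (path_slln (F := fun z => envelope N g alpha z k.+1 * mar (z n) l)).
  - apply: measurable_funM; last exact: measurableT_comp (mmar l) (mat n).
    exact: measurable_envelope.
  - move=> z z' zz'; rewrite zz'//; congr (_ * _).
    by apply: eq_envelope; apply: (inside k.+1 (leqnn _)).
  - apply: (sqintM_bounded senv (M := 1)); last by move=> w; exact: mar1.
    exact: measurableT_comp (mmar l) (mX n).
have margin0 := no_tie_margin_cvg (alp := alp) (bet := bet) (theta := theta)
  mX mg g_ge0 g_sqint alpha_gt0 msig k1N tie.
(* From here on the argument is deterministic: at the outcome [s] the countably many almost sure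
   properties above hold together. *)
near=> s => err.
have h_phi : forall (i : 'I_K) l,
    feature i (Y l s n) = \sum_(j < r) c i j * psi j (Y l s n) by near: s.
have h_gram : forall i j : 'I_r,
    mean m (fun l => psi i (Y l s n) * psi j (Y l s n)) @[m --> \oo]
      --> ((i == j)%:R : R) by near: s.
have h_res : forall j : 'I_r,
    mean m (fun l => (q k (Y l s) - Phi sig alp bet (theta n) (Y l s n)) *
       psi j (Y l s n)) @[m --> \oo] --> (0 : R) by near: s.
have h_mar : forall l,
    mean m (fun i => envelope N g alpha (Y i s) k.+1 * mar (Y i s n) l) @[m --> \oo]
    --> (\int[Q]_w (envelope N g alpha (X ^~ w) k.+1 * mar (X n w) l) : R) by near: s.
pose y i l := Y i s l.
apply: (@stopped_values_cvg R S 'I_K feature (fun l => Y l s n) r psi c B psiB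
  (fun l i => h_phi i l) (fun i j ir jr => h_gram (Ordinal ir) (Ordinal jr))
  (theta n) (fun m => thhat m s n) (fun l => q k (Y l s))
  (fun m l => paux N g alpha sig alp bet y (thhat m s) k l)
  (fun j jr => h_res (Ordinal jr)) _ err g alpha
  (fun m l => paux N g alpha sig alp bet y (thhat m s) k.+1 l)
  (fun l => q k.+1 (Y l s)) (fun l => envelope N g alpha (Y l s) k.+1)
  (fun l => \int[Q]_w (envelope N g alpha (X ^~ w) k.+1 * mar (X n w) l))) => //.
- move=> m th; have := thhat_min m s n1' th.
  by rewrite /emp_loss /pemp /n subnSK// subKn.
- by move=> m l; exact: paux_bounds.
- by move=> l; exact: (paux_bounds N sig alp bet g_ge0 alpha_gt0 (fun=> Y l s)).
Unshelve. all: by end_near. Qed.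

Lemma mean_pathval_cvg k : (k < N)%N ->
  {ae P, forall s, mean m (fun i => q k (Y i s)) @[m --> \oo] -->
     (\int[Q]_w q k (X ^~ w) : R)}.
Proof.
move=> kN; apply: path_slln.
- exact: measurable_pathval measurable_path_at.
- move=> z z' zz'; apply: eq_paux => n /andP[h1 h2]; apply: zz'.
  by rewrite h2 andbT (leq_trans _ h1)// subn_gt0.
- exact: (sqint_pathval alp bet theta mX mg g_ge0 g_sqint alpha_gt0 msig (ltnW kN)).
Qed.

End ImplementableAlgorithm.

(** * Convergence of the price *)

Unset Implicit Arguments.

Theorem theorem7 (R : realType) (d N K : nat)
  (* pricing probability space and the Markov process X = (X_0, ..., X_N) *)
  (dO : measure_display) (Om : measurableType dO) (Q : probability Om R)
  (X : nat -> Om -> d.-tuple R) (x0 : d.-tuple R)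
  (kap : nat -> R.-pker (d.-tuple R) ~> (d.-tuple R))
  (* payoff, discount, activation, realized random features *)
  (g : d.-tuple R -> R) (alpha : R) (sig : R -> R)
  (alp : 'I_K -> d.-tuple R) (bet : 'I_K -> R)
  (* coefficients of the L^2(pi_n)-projections in the idealized algorithm *)
  (theta : nat -> 'I_K -> R)
  (* sampling probability space, i.i.d. sample paths, regression coefficients *)
  (dS : measure_display) (Sm : measurableType dS) (P : probability Sm R)
  (Y : nat -> Sm -> nat -> d.-tuple R)
  (thhat : nat -> Sm -> nat -> 'I_K -> R) :
  (0 < N)%N ->
  (forall n, measurable_fun setT (X n)) ->
  (forall w, X 0%N w = x0) ->
  (* Markov property (natural filtration) with transition kernels kap n:
     E[ 1_{B_0}(X_0)...1_{B_n}(X_n) 1_A(X_{n+1}) ] = E[ 1_{B_0}(X_0)...1_{B_n}(X_n) kap_n(X_n, A) ] *)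
  (forall n (B : nat -> set (d.-tuple R)) (A : set (d.-tuple R)),
      (n < N)%N -> (forall j, measurable (B j)) -> measurable A ->
      Q ((\bigcap_(j in [set j | (j <= n)%N]) (X j @^-1` B j)) `&` (X n.+1 @^-1` A))
      = (\int[Q]_(w in \bigcap_(j in [set j | (j <= n)%N]) (X j @^-1` B j))
           kap n (X n w) A)%E) ->
  measurable_fun setT g -> (forall x, 0 <= g x) ->
  (forall n, (n <= N)%N -> Q.-integrable setT (fun w => ((g (X n w)) ^+ 2)%:E)) ->
  0 < alpha ->
  measurable_fun setT sig -> (exists M : R, forall t, `|sig t| <= M) ->
  (* theta n is a minimizer: Phi theta_n = Pi_n^K E_n P_{n+1}^K *)
  (forall n, (n < N)%N -> forall th : 'I_K -> R,
      (l2sq Q X n (fun x => (condE kap n (Pideal N kap g alpha sig alp bet theta n.+1) x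
                            - Phi sig alp bet (theta n) x)%R)
       <= l2sq Q X n (fun x => (condE kap n (Pideal N kap g alpha sig alp bet theta n.+1) x
                               - Phi sig alp bet th x)%R))%E) ->
  (* no-tie assumption *)
  (forall n, (n < N)%N ->
      Q [set w | alpha * Phi sig alp bet (theta n) (X n w) = g (X n w)] = 0%E) ->
  (* the sample paths (x_1^i, ..., x_N^i), i = 0, 1, 2, ..., are i.i.d. copies of (X_1, ..., X_N) *)
  (forall i n, (1 <= n <= N)%N -> measurable_fun setT (fun w => Y i w n)) ->
  (forall (s : seq nat) (B : nat -> set (N.-tuple (d.-tuple R))),
      uniq s -> (forall i, measurable (B i)) ->
      P (\bigcap_(i in [set` s]) (samplepath N (fun n w => Y i w n) @^-1` B i))
      = (\prod_(i <- s) Q (samplepath N X @^-1` B i))%E) ->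
  (* hat theta_n (for m samples) minimizes the empirical least-squares loss *)
  (forall m w n, (1 <= n < N)%N -> forall th : 'I_K -> R,
      emp_loss N g alpha sig alp bet (fun i k => Y i w k) (thhat m w) m n (thhat m w n)
      <= emp_loss N g alpha sig alp bet (fun i k => Y i w k) (thhat m w) m n th) ->
  {ae P, forall w,
     (fun m : nat => price_emp N g alpha sig alp bet (fun i k => Y i w k) (thhat m w) x0 m)
       @ \oo --> (price_ideal N kap g alpha sig alp bet theta x0 : R^o)}.
Proof.
move=> N0 mX X0 markov mg g_ge0 g_sqint alpha0 msig [M sigM] theta_min no_tie.
move=> mY Y_iid thhat_min.
pose err := pathval_error N g alpha sig alp bet theta Y thhat.
(* The base case is exact, as both rules collect [g] at maturity. The last admissible [k] is
   [N - 1], that is date 1, whose values the implementable price averages. *)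
have err_cvg k : (k < N)%N -> {ae P, forall s, err s k m @[m --> \oo] --> (0 : R)}.
  elim: k => [|k IHk] kN.
    apply: aeW => s; rewrite /err /pathval_error /=.
    under eq_fun do under eq_mean do rewrite subrr normr0.
    under eq_fun do rewrite /mean big1// mulr0.
    exact: cvg_cst.
  have nN : (N - k.+1 < N)%N by rewrite ltn_subrL.
  have kE : (N - (N - k.+1).+1 = k)%N by rewrite subnSK ?subKn// ltnW// ltnW.
  have orth j := ideal_residual_orthogonal mX markov mg g_ge0 g_sqint alpha0
    msig sigM nN (theta_min _ nN) j.
  rewrite kE in orth.
  have step := pathval_error_step x0 mX mg g_ge0 g_sqint alpha0 msig sigM
    mY Y_iid thhat_min kN orth (no_tie _ nN).
  by apply: filterS2 (IHk (ltnW kN)) step => s h; exact.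
have N1 : (N - 1 < N)%N by rewrite ltn_subrL.
have avg := mean_pathval_cvg x0 alp bet theta mX mg g_ge0 g_sqint alpha0 msig mY Y_iid N1.
apply: filterS2 (err_cvg _ N1) avg => s es qs.
set c := \int[Q]_w _ in qs.
have cE : c = condE kap 0 (Pideal N kap g alpha sig alp bet theta 1) x0.
  exact: (Rintegral_pathval1 alp bet theta mX markov mg g_ge0 g_sqint alpha0 msig N0 X0).
pose p m i := paux N g alpha sig alp bet (fun i k => Y i s k) (thhat m s) (N - 1)%N i.
have pq m : `|mean m (p m) - mean m (fun i => pathval N g alpha sig alp bet theta (N - 1)%N (Y i s))|
    <= err s (N - 1)%N m.
  rewrite (_ : _ - _ = mean m (fun i => p m i -
    pathval N g alpha sig alp bet theta (N - 1)%N (Y i s))); last first.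
    by rewrite /mean -mulrBr -sumrB.
  exact: ler_norm_mean.
have pc : mean m (p m) @[m --> \oo] --> c.
  have d0 : (fun m => mean m (p m) - mean m (fun i =>
      pathval N g alpha sig alp bet theta (N - 1)%N (Y i s))) @ \oo --> (0 : R).
    apply: (@squeeze_cvgr _ _ _ _ (fun m => - err s (N - 1)%N m) (err s (N - 1)%N)).
    - by apply: nearW => m; rewrite -ler_norml.
    - by rewrite -oppr0; exact: cvgN.
    - exact: es.
  rewrite -(add0r c); apply: cvg_trans; last exact: (cvgD d0 qs).
  apply: near_eq_cvg.
  apply: nearW => m; set u := mean m (p m).
  transitivity (u - mean m (fun i => pathval N g alpha sig alp bet theta (N - 1)%N (Y i s)) +
    mean m (fun i => pathval N g alpha sig alp bet theta (N - 1)%N (Y i s))) => //.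
  by rewrite subrK.
have apc : alpha * mean m (p m) @[m --> \oo] --> alpha * c.
  by apply: cvgM pc; exact: cvg_cst.
rewrite /price_ideal -cE.
have -> : (fun m => price_emp N g alpha sig alp bet (fun i k => Y i s k)
    (thhat m s) x0 m) = (fun m => Num.max (g x0) (alpha * mean m (p m))).
  by apply/funext => m; rewrite /price_emp -meanZ.
have maxc : {for alpha * c, continuous (fun u : R^o => Num.max (g x0) u : R^o)}.
  by apply: continuous_max; [exact: cst_continuous|exact: cvg_id].
exact: (cvg_comp _ _ apc maxc).
Qed.
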